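(* Let $f=(f_1,\dots,f_5):\mathfrak{su}(2)^3\to\mathbb{R}^5$, where $$f_1=\langle a_1,a_2\rangle,\quad f_2=\langle a_2,a_3\rangle,\quad f_3=\langle a_3,a_1\rangle,\quad f_4=\langle a_1,a_1\rangle-\langle a_2,a_2\rangle,\quad f_5=\langle a_2,a_2\rangle-\langle a_3,a_3\rangle .$$ For any $\eta^+\in\mathfrak{su}(2)^3_+$, the symplectic leaf of $\pi_1$ through $\eta^+$ is $$N_{\eta^+}:=f^{-1}(f(\eta^+))\cap\mathfrak{su}(2)^3_+ .$$ Similarly, for any $\eta^-\in\mathfrak{su}(2)^3_-$, the symplectic leaf of $\pi_1$ through $\eta^-$ is $$N_{\eta^-}:=f^{-1}(f(\eta^-))\cap\mathfrak{su}(2)^3_- .$$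
   Context: $\langle\cdot,\cdot\rangle$ is the positive definite Ad-invariant inner product on $\mathfrak{su}(2)$ normalized so that $(\mathfrak{su}(2),[\cdot,\cdot],\langle\cdot,\cdot\rangle)\cong(\mathbb{R}^3,\times,\cdot)$, i.e. $\langle x,y\rangle=-2\operatorname{tr}(xy)$. Let $\Phi(a_1,a_2,a_3)=\langle a_1,[a_2,a_3]\rangle$ on $\mathfrak{su}(2)^3$, and let $\mathfrak{su}(2)^3_\star$, $\mathfrak{su}(2)^3_+$, $\mathfrak{su}(2)^3_-$ be the open subsets where $\Phi\ne0$, $\Phi>0$, $\Phi<0$ respectively. For $\xi\in\mathfrak{su}(2)$ let $l^j_\xi(a_1,a_2,a_3)=\langle\xi,a_j\rangle$. On $\mathfrak{su}(2)^3_\star$ let $A_{\xi,\zeta}=\frac1\Phi\big(\langle[a_1,a_2],\xi\rangle\langle[a_1,a_2],\zeta\rangle+\langle[a_2,a_3],\xi\rangle\langle[a_2,a_3],\zeta\rangle+\langle[a_3,a_1],\xi\rangle\langle[a_3,a_1],\zeta\rangle\big)$. The Poisson structure $\pi_1$ on $\mathfrak{su}(2)^3_\star$ (known to be Poisson, due to Xu) is given by $\{l^1_\xi,l^1_\zeta\}=l^1_{[\xi,\zeta]}$, $\{l^1_\xi,l^2_\zeta\}=\{l^2_\xi,l^1_\zeta\}=l^2_{[\xi,\zeta]}$, $\{l^1_\xi,l^3_\zeta\}=\{l^3_\xi,l^1_\zeta\}=l^3_{[\xi,\zeta]}$, $\{l^2_\xi,l^2_\zeta\}=\{l^3_\xi,l^3_\zeta\}=-l^1_{[\xi,\zeta]}$,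 $\{l^2_\xi,l^3_\zeta\}=-\{l^3_\xi,l^2_\zeta\}=A_{\xi,\zeta}$. Its symplectic distribution $\pi_1^\sharp(T^*\mathfrak{su}(2)^3_\star)$ is regular of rank $4$, spanned by $V_0=([a_2,a_3],[a_3,a_1],[a_1,a_2])$, $V_1=(0,[a_2,a_1],[a_3,a_1])$, $V_2=([a_1,a_2],0,[a_3,a_2])$, $V_3=([a_1,a_3],[a_2,a_3],0)$; symplectic leaves are its maximal connected integral submanifolds. *)

(* Defs.v *)
From HB Require Import structures.
From mathcomp Require Import all_boot all_order all_algebra.
From mathcomp Require Import all_classical all_reals all_analysis.
From mathcomp Require Import complex ring lra.

Set Implicit Arguments.
Unset Strict Implicit.
Unset Printing Implicit Defensive.

Import Order.TTheory GRing.Theory Num.Theory.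
Import numFieldNormedType.Exports.

Local Open Scope classical_set_scope.
Local Open Scope ring_scope.

Section SmoothMaps.
Context {R : realType}.

Fixpoint Ck (n : nat) {V W : normedModType R} (U : set V) (f : V -> W) : Prop :=
  match n with
  | 0 => forall x, U x -> {for x, continuous f}
  | n.+1 => (forall x, U x -> differentiable f x) /\
            (forall v : V, Ck n U (fun x => 'D_v f x))
  end.

(* Only meant for [U] open in a finite-dimensional [V]. *)
Definition smooth_on {V W : normedModType R} (U : set V) (f : V -> W) : Prop :=
  forall n, Ck n U f.

End SmoothMaps.

(* Immersed submanifolds of [E], presented as the image [N] of countably many
   parametrizations [phi i : U i -> E].  The manifold topology of [N] is the one
   for which the [phi i] are homeomorphisms onto open sets: it may be finer than
   the subspace topology, hence is Hausdorff, and it is second countable because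
   the atlas is countable (empty [U i] are allowed). *)
Section Leaves.
Context {R : realType} {E : normedModType R}.
Implicit Types (D : E -> set E) (N M : set E).

Definition overlap k (U : nat -> set 'rV[R]_k) (phi : nat -> 'rV[R]_k -> E)
  (i j : nat) : set 'rV[R]_k := U i `&` phi i @^-1` (phi j @` U j).

Record immersed_atlas k (N : set E) (U : nat -> set 'rV[R]_k)
    (phi : nat -> 'rV[R]_k -> E) : Prop := ImmersedAtlas {
  atlas_open : forall i, open (U i) ;
  atlas_cover : \bigcup_i (phi i @` U i) = N ;
  atlas_inj : forall i, set_inj (U i) (phi i) ;
  atlas_smooth : forall i, smooth_on (U i) (phi i) ;
  atlas_immersion : forall i x, U i x -> injective ('d (phi i) x) ;
  atlas_overlap : forall i j, open (overlap U phi i j) ;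
  atlas_transition : forall i j, exists tau : 'rV[R]_k -> 'rV[R]_k,
    smooth_on (overlap U phi i j) tau /\
    (forall x, overlap U phi i j x -> U j (tau x) /\ phi j (tau x) = phi i x)
}.

Definition atlas_open_set k (N : set E) (U : nat -> set 'rV[R]_k)
    (phi : nat -> 'rV[R]_k -> E) (A : set E) : Prop :=
  A `<=` N /\ forall i, open (U i `&` phi i @^-1` A).

Definition atlas_connected k (N : set E) (U : nat -> set 'rV[R]_k)
    (phi : nat -> 'rV[R]_k -> E) : Prop :=
  N !=set0 /\
  forall A B, atlas_open_set N U phi A -> atlas_open_set N U phi B ->
    A `|` B = N -> A `&` B = set0 -> A = set0 \/ B = set0.

Definition atlas_tangent k D (U : nat -> set 'rV[R]_k)
    (phi : nat -> 'rV[R]_k -> E) : Prop :=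
  forall i x, U i x -> range ('d (phi i) x) = D (phi i x).

Definition connected_integral_submanifold (O : set E) D N : Prop :=
  N `<=` O /\
  exists (k : nat) (U : nat -> set 'rV[R]_k) (phi : nat -> 'rV[R]_k -> E),
    [/\ immersed_atlas N U phi, atlas_tangent D U phi & atlas_connected N U phi].

Definition leaf (O : set E) D N : Prop :=
  connected_integral_submanifold O D N /\
  forall M, connected_integral_submanifold O D M -> N `<=` M -> M = N.

End Leaves.

Local Open Scope complex_scope.

Section Su2.
Variable R : realType.

Definition su2_pred : pred 'M[R[i]]_2 :=
  fun x => (map_mx conjc x^T == - x) && (\tr x == 0).

Record su2 := Su2 { su2_mx :> 'M[R[i]]_2 ; su2P : su2_pred su2_mx }.

HB.instance Definition _ := [isSub for su2_mx].
HB.instance Definition _ := [Choice of su2 by <:].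

Fact su2_zmod_closed : zmod_closed su2_pred.
Proof.
split=> [|x y]; rewrite /in_mem /= /su2_pred.
  by rewrite trmx0 map_mx0 oppr0 mxtrace0 !eqxx.
move=> /andP[/eqP hx /eqP tx] /andP[/eqP hy /eqP ty].
rewrite [\tr _]linearB /= tx ty subr0 eqxx andbT [(_ - _)^T]linearB /= map_mxB hx hy.
by rewrite opprD.
Qed.
HB.instance Definition _ := GRing.isZmodClosed.Build _ su2_pred su2_zmod_closed.
HB.instance Definition _ := [SubChoice_isSubZmodule of su2 by <:].

Fact su2_scale_subproof (c : R) (x : su2) : su2_pred (c%:C *: su2_mx x).
Proof.
have /andP[/eqP hx /eqP tx] := su2P x.
rewrite /su2_pred mxtraceZ tx mulr0 eqxx andbT [(_ *: _)^T]linearZ /=; apply/eqP.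
by rewrite map_mxZ hx scalerN /= oppr0.
Qed.
Definition su2_scale (c : R) (x : su2) : su2 := Su2 (su2_scale_subproof c x).

Fact su2_scaleA a b x : su2_scale a (su2_scale b x) = su2_scale (a * b) x.
Proof. by apply: val_inj; rewrite /= scalerA -rmorphM. Qed.
Fact su2_scale1 : left_id 1 su2_scale.
Proof. by move=> x; apply: val_inj; rewrite /= scale1r. Qed.
Fact su2_scaleDr : right_distributive su2_scale +%R.
Proof. by move=> c x y; apply: val_inj; rewrite /= scalerDr. Qed.
Fact su2_scaleDl x : {morph su2_scale^~ x : a b / a + b}.
Proof. by move=> a b; apply: val_inj; rewrite /= rmorphD scalerDl. Qed.
HB.instance Definition _ := GRing.Zmodule_isLmodule.Build R su2
  su2_scaleA su2_scale1 su2_scaleDr su2_scaleDl.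

Fact bracket_subproof (x y : su2) :
  su2_pred (su2_mx x *m su2_mx y - su2_mx y *m su2_mx x).
Proof.
have /andP[/eqP hx _] := su2P x; have /andP[/eqP hy _] := su2P y.
rewrite /su2_pred [\tr _]linearB /= mxtrace_mulC subrr eqxx andbT; apply/eqP.
rewrite [(_ - _)^T]linearB /= map_mxB !trmx_mul !map_mxM hx hy.
by rewrite !mulNmx !mulmxN !opprK opprB.
Qed.
Definition bracket (x y : su2) : su2 := Su2 (bracket_subproof x y).

(* [\tr (x *m y)] is real on su(2). *)
Definition ip (x y : su2) : R := - 2 * complex.Re (\tr (su2_mx x *m su2_mx y)).

Local Notation i0 := (ord0 : 'I_2).
Local Notation i1 := (ord_max : 'I_2).

Lemma mx2P (T : Type) (A B : 'M[T]_2) : A i0 i0 = B i0 i0 -> A i0 i1 = B i0 i1 ->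
  A i1 i0 = B i1 i0 -> A i1 i1 = B i1 i1 -> A = B.
Proof.
move=> h00 h01 h10 h11; apply/matrixP => i j.
have E (k : 'I_2) : k = i0 \/ k = i1.
  by case: k => [[|[|//]] hk]; [left|right]; apply: val_inj.
by case: (E i) => ->; case: (E j) => ->.
Qed.

(* (u0, u1, u2) is sent to \sum_p u_p * (-i/2) sigma_p, sigma_p the Pauli matrices. *)
Definition su2_vec_mx (u0 u1 u2 : R) : 'M[R[i]]_2 :=
  \matrix_(i, j) nth 0 (nth [::]
    [:: [:: 0 +i* (- u2 / 2) ; (- u1 / 2) +i* (- u0 / 2)] ;
        [:: (u1 / 2) +i* (- u0 / 2) ; 0 +i* (u2 / 2)]] i) j.

Fact su2_vec_subproof u0 u1 u2 : su2_pred (su2_vec_mx u0 u1 u2).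
Proof.
apply/andP; split; apply/eqP.
  by apply: mx2P; rewrite !mxE /=; apply/eqP; rewrite eq_complex /=; apply/andP;
    split; apply/eqP; lra.
rewrite /mxtrace !big_ord_recl big_ord0 !mxE /=.
by apply/eqP; rewrite eq_complex /=; apply/andP; split; apply/eqP; lra.
Qed.
Definition su2_vec u0 u1 u2 : su2 := Su2 (su2_vec_subproof u0 u1 u2).

Lemma su2_vec_surj (x : su2) : exists u0 u1 u2, x = su2_vec u0 u1 u2.
Proof.
have /andP[/eqP hx /eqP] := su2P x.
rewrite /mxtrace !big_ord_recl big_ord0 => tx.
have h00 := congr1 (fun A : 'M[R[i]]_2 => A i0 i0) hx.
have h01 := congr1 (fun A : 'M[R[i]]_2 => A i0 i1) hx.
have i1E : lift ord0 ord0 = i1 by apply: val_inj.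
rewrite i1E addr0 in tx.
move: h00 h01 tx; rewrite !mxE.
case e00 : (su2_mx x i0 i0) => [a b]; case e01 : (su2_mx x i0 i1) => [c d].
case e10 : (su2_mx x i1 i0) => [e f]; case e11 : (su2_mx x i1 i1) => [g h].
move=> /eqP; rewrite eq_complex /= => /andP[/eqP h1 _].
move=> /eqP; rewrite eq_complex /= => /andP[/eqP h2 /eqP h3].
move=> /eqP; rewrite eq_complex /= => /andP[/eqP h4 /eqP h5].
exists (- 2 * d), (- 2 * c), (- 2 * b).
apply: val_inj; apply: mx2P; rewrite !mxE /= ?e00 ?e01 ?e10 ?e11;
  by apply/eqP; rewrite eq_complex /=; apply/andP; split; apply/eqP; lra.
Qed.

Lemma ip_vec u0 u1 u2 v0 v1 v2 :
  ip (su2_vec u0 u1 u2) (su2_vec v0 v1 v2) = u0 * v0 + u1 * v1 + u2 * v2.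
Proof.
rewrite /ip /mxtrace; do ?rewrite !(big_ord_recl, big_ord0, mxE) /=.
by field.
Qed.

Lemma bracket_vec u0 u1 u2 v0 v1 v2 :
  bracket (su2_vec u0 u1 u2) (su2_vec v0 v1 v2) =
  su2_vec (u1 * v2 - u2 * v1) (u2 * v0 - u0 * v2) (u0 * v1 - u1 * v0).
Proof.
apply: val_inj; apply: mx2P;
  do ?rewrite !(big_ord_recl, big_ord0, mxE) /=;
  by apply/eqP; rewrite eq_complex /=; apply/andP; split; apply/eqP; field.
Qed.

Lemma su2_vecD u0 u1 u2 v0 v1 v2 :
  su2_vec u0 u1 u2 + su2_vec v0 v1 v2 = su2_vec (u0 + v0) (u1 + v1) (u2 + v2).
Proof.
by apply: val_inj; apply: mx2P; rewrite !mxE /=; apply/eqP; rewrite eq_complex /=;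
  apply/andP; split; apply/eqP; field.
Qed.

Lemma su2_vecZ c u0 u1 u2 :
  c *: su2_vec u0 u1 u2 = su2_vec (c * u0) (c * u1) (c * u2).
Proof.
by apply: val_inj; apply: mx2P; rewrite !mxE /=; apply/eqP; rewrite eq_complex /=;
  apply/andP; split; apply/eqP; field.
Qed.

Definition su2_norm (x : su2) : R := Num.sqrt (ip x x).

Fact su2_norm_triangle x y : su2_norm (x + y) <= su2_norm x + su2_norm y.
Proof.
have [u0 [u1 [u2 ->]]] := su2_vec_surj x.
have [v0 [v1 [v2 ->]]] := su2_vec_surj y.
rewrite /su2_norm su2_vecD !ip_vec -!expr2.
set p := u0 ^+ 2 + _ + _; set q := v0 ^+ 2 + _ + _.
have p0 : 0 <= p by rewrite !addr_ge0 ?sqr_ge0.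
have q0 : 0 <= q by rewrite !addr_ge0 ?sqr_ge0.
have d : u0 * v0 + u1 * v1 + u2 * v2 <= Num.sqrt p * Num.sqrt q.
  rewrite -sqrtrM //; apply: le_trans (ler_norm _) _.
  rewrite -sqrtr_sqr ler_sqrt ?mulr_ge0 // -subr_ge0.
  rewrite (_ : _ - _ = (u0 * v1 - u1 * v0) ^+ 2 + (u1 * v2 - u2 * v1) ^+ 2
    + (u2 * v0 - u0 * v2) ^+ 2); last by rewrite /p /q; ring.
  by rewrite !addr_ge0 ?sqr_ge0.
rewrite -(ger0_norm (addr_ge0 (sqrtr_ge0 p) (sqrtr_ge0 q))) -sqrtr_sqr.
rewrite ler_sqrt ?sqr_ge0 // [leRHS]sqrrD !sqr_sqrtr //.
by move: d; set r := Num.sqrt p * _; rewrite /p /q; lra.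
Qed.

Fact su2_normZ c x : su2_norm (c *: x) = `|c| * su2_norm x.
Proof.
have [u0 [u1 [u2 ->]]] := su2_vec_surj x.
rewrite /su2_norm su2_vecZ !ip_vec -sqrtr_sqr -sqrtrM ?sqr_ge0 //.
by congr Num.sqrt; ring.
Qed.

Fact su2_norm_eq0 x : su2_norm x = 0 -> x = 0.
Proof.
have [u0 [u1 [u2 ->]]] := su2_vec_surj x.
rewrite /su2_norm ip_vec => /eqP; rewrite sqrtr_eq0 -!expr2 => h.
have h0 := sqr_ge0 u0; have h1 := sqr_ge0 u1; have h2 := sqr_ge0 u2.
have /eqP : u0 ^+ 2 = 0 by lra.
have /eqP : u1 ^+ 2 = 0 by lra.
have /eqP : u2 ^+ 2 = 0 by lra.
rewrite !sqrf_eq0 => /eqP-> /eqP-> /eqP->.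
by apply: val_inj; apply: mx2P; rewrite !mxE /=; apply/eqP; rewrite eq_complex /=;
  apply/andP; split; apply/eqP; field.
Qed.

HB.instance Definition _ := Lmodule_isNormed.Build R su2
  su2_norm_triangle su2_normZ su2_norm_eq0.

End Su2.

Section Poisson.
Variable R : realType.

Definition su2_3 : normedModType R := (su2 R * su2 R * su2 R)%type.

(* [entry a j] is the entry a_{j+1}; indices are shifted to start at 0. *)
Definition entry (a : su2_3) (j : 'I_3) : su2 R :=
  match val j with 0 => a.1.1 | 1 => a.1.2 | _ => a.2 end.

Definition incl (j : 'I_3) (x : su2 R) : su2_3 :=
  match val j with 0 => (x, 0, 0) | 1 => (0, x, 0) | _ => (0, 0, x) end.

Definition Phi (a : su2_3) : R := ip a.1.1 (bracket a.1.2 a.2).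

Definition su2_3_star : set su2_3 := [set a | Phi a != 0].
Definition su2_3_plus : set su2_3 := [set a | 0 < Phi a].
Definition su2_3_minus : set su2_3 := [set a | Phi a < 0].

Definition lin (j : 'I_3) (xi : su2 R) (a : su2_3) : R^o := ip xi (entry a j).

Definition Aform (a : su2_3) (xi zeta : su2 R) : R :=
  (Phi a)^-1 *
  (ip (bracket a.1.1 a.1.2) xi * ip (bracket a.1.1 a.1.2) zeta
   + ip (bracket a.1.2 a.2) xi * ip (bracket a.1.2 a.2) zeta
   + ip (bracket a.2 a.1.1) xi * ip (bracket a.2 a.1.1) zeta).

(* The value at [a] of the Poisson bracket of [lin j xi] and [lin k zeta]. *)
Definition bracket_lin (a : su2_3) (j k : 'I_3) (xi zeta : su2 R) : R :=
  match val j, val k with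
  | 0, 0 => lin 0 (bracket xi zeta) a
  | 0, 1 | 1, 0 => lin 1 (bracket xi zeta) a
  | 0, _ | _, 0 => lin 2 (bracket xi zeta) a
  | 1, 1 => - lin 0 (bracket xi zeta) a
  | 1, _ => Aform a xi zeta
  | _, 1 => - Aform a xi zeta
  | _, _ => - lin 0 (bracket xi zeta) a
  end.

Definition su2_basis (p : 'I_3) : su2 R :=
  su2_vec (p == 0)%:R (p == 1)%:R (p == 2)%:R.

(* The bivector at [a]: covectors are linear forms on [su2_3], and [su2_basis]
   is orthonormal, so that a covector [alpha] equals
   \sum_(j, p) alpha (incl j (su2_basis p)) *: lin j (su2_basis p). *)
Definition pi1 (a : su2_3) (alpha beta : {linear su2_3 -> R^o}) : R :=
  \sum_(j < 3) \sum_(p < 3) \sum_(k < 3) \sum_(q < 3)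
    alpha (incl j (su2_basis p)) * beta (incl k (su2_basis q)) *
    bracket_lin a j k (su2_basis p) (su2_basis q).

Fact lin_is_linear j xi : linear (lin j xi).
Proof.
have ipD c u v : ip xi (c *: u + v) = c * ip xi u + ip xi v.
  have [x0 [x1 [x2 ->]]] := su2_vec_surj xi.
  have [u0 [u1 [u2 ->]]] := su2_vec_surj u.
  have [v0 [v1 [v2 ->]]] := su2_vec_surj v.
  by rewrite su2_vecZ su2_vecD !ip_vec; ring.
move=> c u v; rewrite /lin.
by case: j => [[|[|[|//]]] hj]; rewrite /entry /= ipD.
Qed.
HB.instance Definition _ j xi := GRing.isLinear.Build R su2_3 R^o _ (lin j xi)
  (lin_is_linear j xi).

Lemma lin_incl (j k : 'I_3) (xi x : su2 R) :
  lin j xi (incl k x) = if j == k then ip xi x else 0.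
Proof.
have ip0 : ip xi 0 = 0 by rewrite /ip mulmx0 mxtrace0 mulr0.
by case: j => [[|[|[|//]]] hj]; case: k => [[|[|[|//]]] hk];
  rewrite /lin /entry /incl -val_eqE //=.
Qed.

Lemma bracket_linP (a : su2_3) (j k : 'I_3) :
  (exists c w, forall x z, bracket_lin a j k x z = c * ip (bracket x z) w) \/
  (exists c u v w, forall x z, bracket_lin a j k x z =
     c * (ip u x * ip u z + ip v x * ip v z + ip w x * ip w z)).
Proof.
case: j => [[|[|[|//]]] hj]; case: k => [[|[|[|//]]] hk]; rewrite /bracket_lin /=.
- by left; exists 1, a.1.1 => x z; rewrite mul1r.
- by left; exists 1, a.1.2 => x z; rewrite mul1r.
- by left; exists 1, a.2 => x z; rewrite mul1r.
- by left; exists 1, a.1.2 => x z; rewrite mul1r.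
- by left; exists (-1), a.1.1 => x z; rewrite mulN1r.
- by right; exists (Phi a)^-1, (bracket a.1.1 a.1.2), (bracket a.1.2 a.2),
    (bracket a.2 a.1.1).
- by left; exists 1, a.2 => x z; rewrite mul1r.
- right; exists (- (Phi a)^-1), (bracket a.1.1 a.1.2), (bracket a.1.2 a.2),
    (bracket a.2 a.1.1) => x z.
  by rewrite mulNr.
- by left; exists (-1), a.1.1 => x z; rewrite mulN1r.
Qed.

Lemma pi1_lin (a : su2_3) (j k : 'I_3) (xi zeta : su2 R) :
  pi1 a (lin j xi) (lin k zeta) = bracket_lin a j k xi zeta.
Proof.
have E b : pi1 a (lin j xi) b = \sum_(p < 3) \sum_(k' < 3) \sum_(q < 3)
    ip xi (su2_basis p) * b (incl k' (su2_basis q)) *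
    bracket_lin a j k' (su2_basis p) (su2_basis q).
  rewrite /pi1 (bigD1 j) //= [X in _ + X]big1 ?addr0 => [|j' jj'].
    by under eq_bigr do under eq_bigr do under eq_bigr do rewrite lin_incl eqxx.
  by do 3!(rewrite big1 // => ? _); rewrite lin_incl eq_sym (negPf jj') !mul0r.
rewrite E.
have {E}-> : \sum_(p < 3) \sum_(k' < 3) \sum_(q < 3)
    ip xi (su2_basis p) * lin k zeta (incl k' (su2_basis q)) *
    bracket_lin a j k' (su2_basis p) (su2_basis q) =
  \sum_(p < 3) \sum_(q < 3) ip xi (su2_basis p) * ip zeta (su2_basis q) *
    bracket_lin a j k (su2_basis p) (su2_basis q).
  apply: eq_bigr => p _.
  rewrite (bigD1 k) //= [X in _ + X]big1 ?addr0 => [|k' kk'].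
    by under eq_bigr do rewrite lin_incl eqxx.
  by rewrite big1 // => q _; rewrite lin_incl eq_sym (negPf kk') mulr0 mul0r.
have sum3 (F : 'I_3 -> R) : \sum_p F p = F 0 + F 1 + F 2.
  rewrite 3!big_ord_recl big_ord0 addr0 addrA.
  by congr (F _ + F _ + F _); apply: val_inj.
under eq_bigr do rewrite sum3.
rewrite sum3.
have e0 : su2_basis 0 = su2_vec 1 0 0 by [].
have e1 : su2_basis 1 = su2_vec 0 1 0 by [].
have e2 : su2_basis 2 = su2_vec 0 0 1 by [].
rewrite e0 e1 e2.
have [x0 [x1 [x2 ->]]] := su2_vec_surj xi.
have [z0 [z1 [z2 ->]]] := su2_vec_surj zeta.
move: (bracket_lin a j k) (bracket_linP a j k) => B [[c [w BE]]|[c [w [w' [w'' BE]]]]].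
  have [w0 [w1 [w2 wE]]] := su2_vec_surj w.
  by rewrite !BE wE !(bracket_vec, ip_vec); ring.
have [u0 [u1 [u2 uE]]] := su2_vec_surj w.
have [v0 [v1 [v2 vE]]] := su2_vec_surj w'.
have [t0 [t1 [t2 tE]]] := su2_vec_surj w''.
by rewrite !BE uE vE tE !ip_vec; ring.
Qed.

(* [v] is pi1^sharp (alpha); linear forms separate the points of [su2_3], so it
   is unique. *)
Definition is_sharp1 (a : su2_3) (alpha : {linear su2_3 -> R^o}) (v : su2_3) :=
  forall beta : {linear su2_3 -> R^o}, beta v = pi1 a alpha beta.

Definition symplectic_distribution (a : su2_3) : set su2_3 :=
  [set v | exists alpha, is_sharp1 a alpha v].

Definition symplectic_leaf_through (eta : su2_3) (N : set su2_3) : Prop :=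
  leaf su2_3_star symplectic_distribution N /\ N eta.

Definition f_map (a : su2_3) : 'rV[R]_5 :=
  \row_(i < 5) nth 0 [:: ip a.1.1 a.1.2 ; ip a.1.2 a.2 ; ip a.2 a.1.1 ;
    ip a.1.1 a.1.1 - ip a.1.2 a.1.2 ; ip a.1.2 a.1.2 - ip a.2 a.2] i.

End Poisson.

(* Main.v *)
From Pilot Require Import Defs.
From mathcomp Require Import all_boot all_order all_algebra.
From mathcomp Require Import all_classical all_reals all_analysis.
From mathcomp Require Import ring lra.

(** Writing [a] as the 3 x 3 matrix A with columns a_1, a_2, a_3, the inner
    products form A^T A and [Phi a] is det A.  The value of [f_map] determines
    A^T A up to a multiple of the identity, so a fibre of [f_map] consists of
    the A with A^T A = S + t I for a fixed S and some t.

    The symplectic distribution at a point where [Phi] does not vanish is the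
    kernel of the differential of [f_map] ([symplectic_distributionE]): both are
    the space [gram_tangent a] of directions in which A^T A moves by a multiple
    of the identity.  The sharps of the forms [lin 0 xi] are the infinitesimal
    rotations, the sharp of [lin 1 a_3] is the field V_0, which moves t, and four
    linear functionals separate the points of the kernel, so these sharps fill
    it.  Hence [f_map] is locally constant on every integral submanifold, as is
    the sign of [Phi], and a connected one lies in a single fibre, on one side
    of the zeros of [Phi] ([integral_submanifold_sub]).

    Conversely the set of the A with A^T A = S + t I and det A of a given sign
    is a connected integral submanifold ([fibre_integral_submanifold]).  Such an
    A is uniquely Q L(t), with Q a rotation and L(t) the upper triangular
    Cholesky factor of S + t I, its last diagonal entry given the sign of det A;
    and t ranges over the values for which S + t I is positive definite, which
    form an interval.  So this set is SO(3) times an interval.  A rotation is a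
    line in the space R^4 of quaternions, and the four affine charts q_i = 1 of
    projective space, together with t, give four charts of the set.  They are
    explicit in rational functions and square roots, hence smooth, and they
    share a point, hence connectedness.  They are immersions because q and t
    are recovered from A by explicit formulas, and since the tangent space of the set is
    contained in a kernel of dimension at most four, it is equal to it.

    The two facts together make this set a leaf; a leaf through one of its
    points is contained in it, and so equals it by maximality ([fibre_leaf]).
    A factor [sg] with [sg * sg = 1] treats both signs of [Phi] at once. *)

Set Implicit Arguments.
Unset Strict Implicit.
Unset Printing Implicit Defensive.

Import Order.TTheory GRing.Theory Num.Theory.
Import numFieldNormedType.Exports.

Local Open Scope classical_set_scope.
Local Open Scope ring_scope.

(* The inclusion of a summand of su(2)^3, not that of sets. *)
Local Notation incl := Pilot.Defs.incl.

(** * Small index types *)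

Lemma ord3P (j : 'I_3) : [\/ j = 0, j = 1 | j = 2].
Proof.
by case: j => [[|[|[|//]]] h]; [apply: Or31|apply: Or32|apply: Or33]; apply: val_inj.
Qed.

Lemma sum_ord3 (W : zmodType) (F : 'I_3 -> W) : \sum_p F p = F 0 + F 1 + F 2.
Proof.
rewrite 3!big_ord_recl big_ord0 addr0 addrA.
by congr (F _ + F _ + F _); apply: val_inj.
Qed.

Lemma ord4P (k : 'I_4) : [\/ k = 0, k = 1, k = 2 | k = 3].
Proof.
by case: k => [[|[|[|[|//]]]] h]; [apply: Or41|apply: Or42|apply: Or43|apply: Or44];
  apply: val_inj.
Qed.

Lemma sum_ord4 (W : zmodType) (f : 'I_4 -> W) : \sum_k f k = f 0 + f 1 + f 2 + f 3.
Proof.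
rewrite 4!big_ord_recl big_ord0 addr0 !addrA.
by congr (f _ + f _ + f _ + f _); apply: val_inj.
Qed.

(** * Rotation matrices and quaternions *)

Section Rotations.
Variable F : realFieldType.
Implicit Types (M N : 'M[F]_3) (P : 'I_4 -> 'I_4 -> F) (q : 'I_4 -> F).

Definition det3 M :=
  M 0 0 * (M 1 1 * M 2 2 - M 1 2 * M 2 1) - M 0 1 * (M 1 0 * M 2 2 - M 1 2 * M 2 0)
  + M 0 2 * (M 1 0 * M 2 1 - M 1 1 * M 2 0).

Lemma det3M M N : det3 (M *m N) = det3 M * det3 N.
Proof. by rewrite /det3 !mxE !sum_ord3; ring. Qed.

Lemma det3_tr M : det3 M^T = det3 M.
Proof. by rewrite /det3 !mxE; ring. Qed.

Definition adj3 M : 'M[F]_3 := \matrix_(i, j)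
  (M (j + 1) (i + 1) * M (j + 2) (i + 2) - M (j + 1) (i + 2) * M (j + 2) (i + 1)).

(** Cramer rule, which yields invertibility and the cofactor identities of
    rotations. *)
Lemma mul_adj3 M : M *m adj3 M = (det3 M)%:M.
Proof.
apply/matrixP => i j; rewrite !mxE sum_ord3 !mxE /det3.
have s0 : 2 + 1 = 0 :> 'I_3 by apply: val_inj.
have s1 : 2 + 2 = 1 :> 'I_3 by apply: val_inj.
have s2 : 1 + 1 = 2 :> 'I_3 by apply: val_inj.
have s3 : 1 + 2 = 0 :> 'I_3 by apply: val_inj.
by case: (ord3P i) => ->; case: (ord3P j) => ->; rewrite ?add0r ?s0 ?s1 ?s2 ?s3 /=; ring.
Qed.

Lemma det3_unit M : det3 M != 0 -> M \in unitmx.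
Proof.
move=> d0; suff /mulmx1_unit[] : M *m ((det3 M)^-1 *: adj3 M) = 1%:M by [].
by rewrite -scalemxAr mul_adj3 scale_scalar_mx mulVf.
Qed.

(** The inverse of a rotation is at once its transpose and its adjugate;
    entrywise this says that each entry equals its cofactor. *)
Lemma SO3_adj M : M^T *m M = 1%:M -> det3 M = 1 -> adj3 M = M^T.
Proof.
move=> MM d1; have := mul_adj3 M; rewrite d1 => /(congr1 (mulmx M^T)).
by rewrite mulmxA MM mul1mx mulmx1.
Qed.

(** The rotation attached to a quaternion q is quadratic in q, hence linear in
    the rank one projection q q^T / |q|^2.  It is written here as a linear
    function of that projection [P], with index 0 for the real part of q. *)
Definition rot_of_proj P : 'M[F]_3 := \matrix_(i, j) nth 0 (nth [::]
  [:: [:: P 0 0 + P 1 1 - P 2 2 - P 3 3; 2 * (P 1 2 - P 0 3); 2 * (P 1 3 + P 0 2)];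
      [:: 2 * (P 1 2 + P 0 3); P 0 0 - P 1 1 + P 2 2 - P 3 3; 2 * (P 2 3 - P 0 1)];
      [:: 2 * (P 1 3 - P 0 2); 2 * (P 2 3 + P 0 1); P 0 0 - P 1 1 - P 2 2 + P 3 3]] i) j.

(** The affine inverse of [rot_of_proj] on symmetric matrices of trace 1.  Since
    it is affine in the entries of the rotation, the line of the quaternion
    depends smoothly on the rotation. *)
Definition proj_of_rot M : 'M[F]_4 := 4^-1 *: \matrix_(k, l) nth 0 (nth [::]
  [:: [:: 1 + M 0 0 + M 1 1 + M 2 2; M 2 1 - M 1 2; M 0 2 - M 2 0; M 1 0 - M 0 1];
      [:: M 2 1 - M 1 2; 1 + M 0 0 - M 1 1 - M 2 2; M 0 1 + M 1 0; M 0 2 + M 2 0];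
      [:: M 0 2 - M 2 0; M 0 1 + M 1 0; 1 - M 0 0 + M 1 1 - M 2 2; M 1 2 + M 2 1];
      [:: M 1 0 - M 0 1; M 0 2 + M 2 0; M 1 2 + M 2 1; 1 - M 0 0 - M 1 1 + M 2 2]] k) l.

Lemma rot_of_projK P : (forall k l, P k l = P l k) -> \sum_k P k k = 1 ->
  forall k l, proj_of_rot (rot_of_proj P) k l = P k l.
Proof.
move=> sP; rewrite sum_ord4 => trP k l; rewrite !mxE /=.
have := (sP 1 0, sP 2 0, sP 3 0, sP 2 1, sP 3 1, sP 3 2) => -[[[[[e1 e2] e3] e4] e5] e6].
by case: (ord4P k) => ->; case: (ord4P l) => -> /=; lra.
Qed.

Lemma proj_of_rotK M : rot_of_proj (proj_of_rot M) = M.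
Proof.
apply/matrixP => i j; rewrite !mxE /=.
by case: (ord3P i) => ->; case: (ord3P j) => -> /=; lra.
Qed.

Definition quat_sqnorm q := \sum_k q k ^+ 2.
(** The orthogonal projection of R^4 onto the line of [q]. *)
Definition line_proj q (k l : 'I_4) := q k * q l / quat_sqnorm q.
Definition quat_rot q := rot_of_proj (line_proj q).

Lemma quat_rot_orthogonal q : quat_sqnorm q != 0 -> (quat_rot q)^T *m quat_rot q = 1%:M.
Proof.
move=> q0; apply/matrixP => i j; rewrite !mxE !sum_ord3 !mxE.
move: q0; rewrite /line_proj /quat_sqnorm sum_ord4 => q0.
by case: (ord3P i) => ->; case: (ord3P j) => -> /=; field.
Qed.

Lemma quat_rot_det q : quat_sqnorm q != 0 -> det3 (quat_rot q) = 1.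
Proof.
by rewrite /det3 !mxE /= /line_proj /quat_sqnorm sum_ord4 => q0; field.
Qed.

(** These quadratic relations say that the symmetric matrix attached to a
    rotation has rank one.  They are linear combinations of the orthonormality
    of rows and columns and of the cofactor identities. *)
Lemma SO3_rank1 M : M^T *m M = 1%:M -> det3 M = 1 ->
  forall k l m, proj_of_rot M k m * proj_of_rot M l m = proj_of_rot M k l * proj_of_rot M m m.
Proof.
move=> MM d1; have /matrixP A := SO3_adj MM d1.
have /matrixP MM' := mulmx1C MM; move/matrixP: MM => MM.
have s0 : 2 + 1 = 0 :> 'I_3 by apply: val_inj.
have s1 : 2 + 2 = 1 :> 'I_3 by apply: val_inj.
have s2 : 1 + 1 = 2 :> 'I_3 by apply: val_inj.
have s3 : 1 + 2 = 0 :> 'I_3 by apply: val_inj.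
move=> k l m.
move: (A 0 0) (A 0 1) (A 0 2) (A 1 0) (A 1 1) (A 1 2) (A 2 0) (A 2 1) (A 2 2).
move: (MM 0 0) (MM 0 1) (MM 0 2) (MM 1 1) (MM 1 2) (MM 2 2).
move: (MM' 0 0) (MM' 0 1) (MM' 0 2) (MM' 1 1) (MM' 1 2) (MM' 2 2).
rewrite !mxE !sum_ord3 !mxE ?add0r ?s0 ?s1 ?s2 ?s3 /=; clear.
move: (M 0 0) (M 0 1) (M 0 2) (M 1 0) (M 1 1) (M 1 2) (M 2 0) (M 2 1) (M 2 2).
case: (ord4P k) => ->; case: (ord4P l) => ->; case: (ord4P m) => -> /=;
  by move=> *; lra.
Qed.

(** The projection [P] of trace 1 attached to a rotation has a nonzero diagonal
    entry, say at [m]; as [P] has rank one, its column [m] spans the line of the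
    quaternion, and is scaled so that coordinate [m] is 1. *)
Lemma SO3_rot M : M^T *m M = 1%:M -> det3 M = 1 ->
  exists q m, q m = 1 /\ quat_rot q = M.
Proof.
move=> MM d1; have rk1 := SO3_rank1 MM d1; set P := proj_of_rot M in rk1.
have Psym k l : P k l = P l k.
  by rewrite !mxE; case: (ord4P k) => ->; case: (ord4P l) => -> /=; ring.
have trP : \sum_k P k k = 1 by rewrite sum_ord4 !mxE /=; field.
have [m Pm] : exists m, P m m != 0.
  apply/existsP; apply: contra_eqT trP => /existsPn P0.
  by rewrite big1 1?eq_sym ?oner_eq0 // => k _; apply/eqP; rewrite -[_ == _]negbK P0.
(* Column [m] of [P], normalized at [m]. *)
pose q k := P k m / P m m.
exists q, m; split; first by rewrite /q divff.
rewrite -[RHS]proj_of_rotK /quat_rot; congr rot_of_proj; apply/funext => k; apply/funext => l.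
have -> : line_proj q k l = P k l; last by [].
have nq : quat_sqnorm q = (P m m)^-1.
  rewrite /quat_sqnorm -[RHS]mul1r -trP mulr_suml; apply: eq_bigr => j _.
  by rewrite /q expr2 mulf_div rk1 -mulf_div divff // mulr1.
by rewrite /line_proj nq invrK /q mulf_div rk1 mulrC; field.
Qed.

Lemma line_proj_scale (c : F) q : c != 0 -> line_proj (fun k => c * q k) = line_proj q.
Proof.
move=> c0; apply/funext => k; apply/funext => l; rewrite /line_proj /quat_sqnorm.
under eq_bigr do rewrite exprMn.
by rewrite -mulr_sumr mulrACA -expr2 -mulf_div divff ?mul1r // sqrf_eq0.
Qed.

Lemma quat_sqnorm_gt0 q m : q m = 1 -> 0 < quat_sqnorm q.
Proof.
move=> qm; rewrite /quat_sqnorm (bigD1 m) //= qm expr1n ltr_pwDl //.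
by rewrite sumr_ge0 // => k _; exact: sqr_ge0.
Qed.

Lemma proj_of_quat_rot q : quat_sqnorm q != 0 ->
  forall k l, proj_of_rot (quat_rot q) k l = line_proj q k l.
Proof.
move=> q0; apply: rot_of_projK => [k l|]; first by rewrite /line_proj [q k * _]mulrC.
by rewrite /line_proj -mulr_suml divff.
Qed.

End Rotations.

(** * Cholesky factor of a shifted Gram matrix *)

Section Cholesky.
Variable R : rcfType.
Variables (sg s00 s11 s22 s01 s02 s12 : R).
Hypothesis sg2 : sg * sg = 1.

Definition minor1 t := s00 + t.
Definition minor2 t := (s00 + t) * (s11 + t) - s01 ^+ 2.
Definition minor3 t := (s00 + t) * (s11 + t) * (s22 + t) + 2 * s01 * s12 * s02
  - (s00 + t) * s12 ^+ 2 - (s11 + t) * s02 ^+ 2 - (s22 + t) * s01 ^+ 2.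

(** Sylvester criterion for [shifted_gram t]. *)
Definition posdef t := [&& 0 < minor1 t, 0 < minor2 t & 0 < minor3 t].

(** A positive definite matrix remains so when a nonnegative multiple of the
    identity is added.  In terms of minors, the coefficients of the powers of
    the shift d in the leading minors are sums of principal minors, so the other
    principal minors have to be positive too. *)
Lemma posdef_up t u : posdef t -> t <= u -> posdef u.
Proof.
move=> pt tu; have {tu}[d d0 ->] : exists2 d, 0 <= d & u = t + d.
  by exists (u - t); rewrite ?subr_ge0 // subrKC.
move: pt; rewrite /posdef /minor1 /minor2 /minor3 !addrA.
move: (s00 + t) (s11 + t) (s22 + t) => a b c /and3P[a0 ab0 D0].
set m := a * b - _ in ab0; set D := (X in 0 < X) in D0.
have b0 : 0 < b.
  rewrite -(pmulr_rgt0 _ a0); apply: lt_le_trans ab0 _.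
  by rewrite /m gerBl sqr_ge0.
(* The other two principal minors of size two, by the Desnanot-Jacobi identity.
   *)
have ac0 : 0 < a * c - s02 ^+ 2.
  rewrite -(pmulr_rgt0 _ ab0).
  have -> : m * (a * c - s02 ^+ 2) = a * D + (a * s12 - s01 * s02) ^+ 2.
    by rewrite /m /D; ring.
  by rewrite ltr_wpDr ?sqr_ge0 // mulr_gt0.
have bc0 : 0 < b * c - s12 ^+ 2.
  rewrite -(pmulr_rgt0 _ ab0).
  have -> : m * (b * c - s12 ^+ 2) = b * D + (b * s02 - s01 * s12) ^+ 2.
    by rewrite /m /D; ring.
  by rewrite ltr_wpDr ?sqr_ge0 // mulr_gt0.
have c0 : 0 < c.
  rewrite -(pmulr_rgt0 _ a0); apply: lt_le_trans ac0 _.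
  by rewrite gerBl sqr_ge0.
apply/and3P; split; first by rewrite ltr_wpDr.
  have -> : (a + d) * (b + d) - s01 ^+ 2 = m + d * (a + b + d) by rewrite /m; ring.
  by rewrite ltr_wpDr // mulr_ge0 // !addr_ge0 // ?ltW.
have -> : (a + d) * (b + d) * (c + d) + 2 * s01 * s12 * s02 - (a + d) * s12 ^+ 2
    - (b + d) * s02 ^+ 2 - (c + d) * s01 ^+ 2 =
  D + d * (m + (a * c - s02 ^+ 2) + (b * c - s12 ^+ 2) + d * (a + b + c + d)).
  by rewrite /D /m; ring.
have trd : 0 <= a + b + c + d by apply: addr_ge0 => //; rewrite !addr_ge0 // ltW.
have dtr := mulr_ge0 d0 trd.
rewrite ltr_wpDr // mulr_ge0 // addr_ge0 //; apply: ltW.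
by apply: addr_gt0 => //; exact: addr_gt0.
Qed.

(** Upper triangular, with [sg] in the last diagonal entry so that the sign of
    the determinant can be prescribed. *)
Definition chol t : 'M[R]_3 :=
  let r1 := Num.sqrt (minor1 t) in let r2 := Num.sqrt (minor2 t) in
  let r3 := Num.sqrt (minor3 t) in \matrix_(m, j) nth 0 (nth [::]
  [:: [:: r1; s01 / r1; s02 / r1];
      [:: 0; r2 / r1; (minor1 t * s12 - s01 * s02) / (r1 * r2)];
      [:: 0; 0; sg * (r3 / r2)]] m) j.

Definition shifted_gram t : 'M[R]_3 := \matrix_(j, k) nth 0 (nth [::]
  [:: [:: s00 + t; s01; s02]; [:: s01; s11 + t; s12]; [:: s02; s12; s22 + t]] j) k.

Lemma chol_gram t : posdef t -> (chol t)^T *m chol t = shifted_gram t.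
Proof.
move=> /and3P[p1 p2 p3]; apply/matrixP => i j; rewrite !mxE sum_ord3 !mxE.
have := sqr_sqrtr (ltW p1); have := sqr_sqrtr (ltW p2); have := sqr_sqrtr (ltW p3).
have : Num.sqrt (minor1 t) != 0 by rewrite gt_eqF ?sqrtr_gt0.
have : Num.sqrt (minor2 t) != 0 by rewrite gt_eqF ?sqrtr_gt0.
move: p1 p2 p3.
move: (Num.sqrt (minor1 t)) (Num.sqrt (minor2 t)) (Num.sqrt (minor3 t)) => r1 r2 r3.
rewrite /minor1 /minor2 /minor3 => /gt_eqF/negbT p1 /gt_eqF/negbT p2 _ n2 n1 h3 h2 h1.
case: (ord3P i) => ->; case: (ord3P j) => -> /=.
- by rewrite -h1; ring.
- by field; rewrite ?n1 ?n2 ?p1 ?p2.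
- by field; rewrite ?n1 ?n2 ?p1 ?p2.
- by field; rewrite ?n1 ?n2 ?p1 ?p2.
- have -> : s01 / r1 * (s01 / r1) + r2 / r1 * (r2 / r1) + 0 * 0 =
      (s01 ^+ 2 + r2 ^+ 2) / r1 ^+ 2 by field; rewrite ?n1 ?n2 ?p1 ?p2.
  by rewrite h1 h2; field.
- have -> : s01 / r1 * (s02 / r1)
      + r2 / r1 * (((s00 + t) * s12 - s01 * s02) / (r1 * r2)) + 0 * (sg * (r3 / r2)) =
      (s00 + t) * s12 / r1 ^+ 2 by field; rewrite ?n1 ?n2 ?p1 ?p2.
  by rewrite h1; field.
- by field; rewrite ?n1 ?n2 ?p1 ?p2.
- have -> : s02 / r1 * (s01 / r1)
      + ((s00 + t) * s12 - s01 * s02) / (r1 * r2) * (r2 / r1) + (sg * (r3 / r2)) * 0 =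
      (s00 + t) * s12 / r1 ^+ 2 by field; rewrite ?n1 ?n2 ?p1 ?p2.
  by rewrite h1; field.
- have -> : s02 / r1 * (s02 / r1)
      + ((s00 + t) * s12 - s01 * s02) / (r1 * r2)
        * (((s00 + t) * s12 - s01 * s02) / (r1 * r2))
      + (sg * (r3 / r2)) * (sg * (r3 / r2)) =
      s02 ^+ 2 / r1 ^+ 2 + ((s00 + t) * s12 - s01 * s02) ^+ 2 / (r1 ^+ 2 * r2 ^+ 2)
      + (sg * sg) * r3 ^+ 2 / r2 ^+ 2 by field; rewrite ?n1 ?n2 ?p1 ?p2.
  by rewrite h1 h2 h3 sg2; field; apply/andP.
Qed.

Lemma chol_det t : posdef t -> det3 (chol t) = sg * Num.sqrt (minor3 t).
Proof.
move=> /and3P[p1 p2 p3]; rewrite /det3 !mxE /=.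
have : Num.sqrt (minor1 t) != 0 by rewrite gt_eqF ?sqrtr_gt0.
have : Num.sqrt (minor2 t) != 0 by rewrite gt_eqF ?sqrtr_gt0.
move: (Num.sqrt (minor1 t)) (Num.sqrt (minor2 t)) => r1 r2 n2 n1.
by field; rewrite ?n1 ?n2 ?p1 ?p2.
Qed.

Lemma chol_unit t : posdef t -> chol t \in unitmx.
Proof.
move=> pt; apply: det3_unit; rewrite chol_det //; case/and3P: pt => _ _ p3.
rewrite mulf_neq0 //; last by rewrite gt_eqF ?sqrtr_gt0.
by apply/eqP => s0; move: sg2; rewrite s0 mul0r => /eqP; rewrite eq_sym oner_eq0.
Qed.

Lemma gram_minor3 (M : 'M[R]_3) t : M^T *m M = shifted_gram t -> minor3 t = det3 M ^+ 2.
Proof.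
move=> e; rewrite expr2 -{1}(det3_tr M) -det3M e /det3 !mxE /= /minor3; ring.
Qed.

(** The leading minors of a Gram matrix are sums of squares: the squared length
    of the first column, the squared length of the cross product of the first
    two, and the squared determinant.  They vanish only if the determinant does.
    *)
Lemma gram_posdef (M : 'M[R]_3) t : M^T *m M = shifted_gram t -> det3 M != 0 -> posdef t.
Proof.
move=> /[dup] /gram_minor3 m3 /matrixP e d0.
have m3_gt0 : 0 < minor3 t by rewrite m3 exprn_even_gt0.
have m1 : minor1 t = M 0 0 ^+ 2 + M 1 0 ^+ 2 + M 2 0 ^+ 2.
  by have := e 0 0; rewrite !mxE sum_ord3 !mxE /= /minor1 => <-; ring.
have m2 : minor2 t = (M 0 0 * M 1 1 - M 1 0 * M 0 1) ^+ 2
    + (M 1 0 * M 2 1 - M 2 0 * M 1 1) ^+ 2 + (M 2 0 * M 0 1 - M 0 0 * M 2 1) ^+ 2.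
  have := e 0 1; have := e 1 1; have := e 0 0; rewrite !mxE !sum_ord3 !mxE /=.
  by rewrite /minor2 => <- <- <-; ring.
have m1_ge0 : 0 <= minor1 t by rewrite m1 !addr_ge0 ?sqr_ge0.
have m2_ge0 : 0 <= minor2 t by rewrite m2 !addr_ge0 ?sqr_ge0.
have m2_neq0 : minor2 t != 0.
  apply: contraNneq d0; rewrite m2 => n0.
  have h (x y z : R) : x ^+ 2 + y ^+ 2 + z ^+ 2 = 0 -> [/\ x = 0, y = 0 & z = 0].
    move=> /eqP; rewrite !paddr_eq0 ?addr_ge0 ?sqr_ge0 // !sqrf_eq0.
    by move=> /andP[/andP[/eqP-> /eqP->] /eqP->].
  have [n2 n0' n1] := h _ _ _ n0; apply/eqP.
  transitivity (M 0 2 * (M 1 0 * M 2 1 - M 2 0 * M 1 1)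
     + M 1 2 * (M 2 0 * M 0 1 - M 0 0 * M 2 1) + M 2 2 * (M 0 0 * M 1 1 - M 1 0 * M 0 1)).
    by rewrite /det3; ring.
  by rewrite n2 n0' n1; ring.
have m2_gt0 : 0 < minor2 t by rewrite lt_def m2_neq0.
rewrite /posdef m3_gt0 m2_gt0 !andbT lt_def m1_ge0 andbT.
apply: contraTneq m2_gt0; rewrite /minor2 /minor1 => ->.
by rewrite mul0r sub0r oppr_gt0 -leNgt sqr_ge0.
Qed.

End Cholesky.

(** * Calculus of smooth functions *)

Section SmoothCalculus.
Context {R : realType} {V : normedModType R}.
Variable U : set V.
Hypothesis Uo : open U.
Implicit Types (W : normedModType R) (n : nat) (g h : V -> R).

Lemma near_open_eq W (f1 f2 : V -> W) x : {in U, f1 =1 f2} -> U x ->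
  \near x, f1 x = f2 x.
Proof.
move=> e Ux; near=> y; apply: e; rewrite inE.
by near: y; exact: open_nbhs_nbhs.
Unshelve. all: by end_near. Qed.

(** The remainder in the definition of differentiability only involves the
    values near the point, so the differential of [f1] serves for [f2]. *)
Lemma differentiable_near_eq W (f1 f2 : V -> W) x :
  (\near x, f1 x = f2 x) -> differentiable f1 x -> differentiable f2 x.
Proof.
move=> e /diff_locallyP [c /eqaddoP d].
have e0 : \forall z \near (0 : V), f1 (z + x) = f2 (z + x).
  by move: e; rewrite (near_shift (0 : V)) subr0.
have E : f2 \o shift x = cst (f2 x) + 'd f1 x +o_ 0 id.
  apply/eqaddoP => eps eps0; near=> y.
  have dy : `|(f1 \o shift x - (cst (f1 x) + 'd f1 x)) y| <= eps * `|y|.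
    by near: y; exact: d.
  have ey : f1 (y + x) = f2 (y + x) by near: y; exact: e0.
  by move: dy; rewrite /= !fctE /= ey (nbhs_singleton e).
apply/diff_locallyP; rewrite (diff_unique c E); split.
  exact: c.
exact: E.
Unshelve. all: by end_near. Qed.

(** Derivatives only depend on values near a point, which is where openness of
    [U] enters. *)
Lemma Ck_congr n W (f1 f2 : V -> W) :
  {in U, f1 =1 f2} -> Ck n U f1 -> Ck n U f2.
Proof.
elim: n f1 f2 => [|n IH] f1 f2 e /=.
  move=> c x Ux; have := c x Ux; rewrite /prop_for /continuous_at -e ?inE // => cx.
  apply: cvg_trans cx; apply: near_eq_cvg.
  exact: near_open_eq.
move=> [d D]; split=> [x Ux|v]; last first.
  apply: (IH _ _ _ (D v)) => x; rewrite inE => Ux.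
  exact/near_eq_derive/near_open_eq.
by apply: differentiable_near_eq (d x Ux); exact: near_open_eq.
Qed.

Lemma CkS n W (f : V -> W) : Ck n.+1 U f -> Ck n U f.
Proof.
elim: n f => [|n IH] f.
  by move=> [d _] x Ux; apply: differentiable_continuous; exact: d.
by move=> [d D]; split=> // v; apply: IH; exact: D.
Qed.

Lemma Ck_cst n W (w : W) : Ck n U (fun=> w).
Proof.
elim: n w => [|n IH] w; first by move=> x _; exact: cvg_cst.
split=> [x _|v]; first exact: differentiable_cst.
by apply: (Ck_congr _ (IH 0)) => x _; rewrite derive_cst.
Qed.

Lemma CkD n W (f1 f2 : V -> W) : Ck n U f1 -> Ck n U f2 ->
  Ck n U (fun x => f1 x + f2 x).
Proof.
elim: n f1 f2 => [|n IH] f1 f2.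
  by move=> c1 c2 x Ux; apply: cvgD; [exact: c1|exact: c2].
move=> [d1 D1] [d2 D2]; split=> [x Ux|v].
  by apply: differentiableD; [exact: d1|exact: d2].
apply: (Ck_congr _ (IH _ _ (D1 v) (D2 v))) => x; rewrite inE => Ux.
by rewrite -deriveD //; apply: diff_derivable; auto.
Qed.

Lemma CkZl n W (w : W) g : Ck n U (g : V -> R) -> Ck n U (fun x => g x *: w).
Proof.
elim: n g => [|n IH] g.
  by move=> c x Ux; apply: cvgZr_tmp; exact: c.
move=> [d D]; split=> [x Ux|v].
  by apply: differentiableZl; exact: d.
apply: (Ck_congr _ (IH _ (D v))) => x; rewrite inE => Ux.
rewrite !deriveE; try exact: d.
  by rewrite diffZl //; exact: d.
by apply: differentiableZl; exact: d.
Qed.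

Lemma CkM n g h : Ck n U g -> Ck n U h -> Ck n U (fun x => g x * h x).
Proof.
elim: n g h => [|n IH] g h.
  by move=> c1 c2 x Ux; apply: cvgM; [exact: c1|exact: c2].
move=> /[dup] /CkS Cg [d1 D1] /[dup] /CkS Ch [d2 D2]; split=> [x Ux|v].
  by apply: differentiableM; [exact: d1|exact: d2].
apply: (Ck_congr _ (CkD (IH _ _ Cg (D2 v)) (IH _ _ Ch (D1 v)))) => x; rewrite inE => Ux.
by rewrite -deriveM //; apply: diff_derivable; auto.
Qed.

(** The derivative - g^-2 Dg is a product of functions that are of class C^n by
    induction. *)
Lemma CkV n g : (forall x, U x -> g x != 0) -> Ck n U g ->
  Ck n U (fun x => (g x)^-1).
Proof.
move=> g0; elim: n => [|n IH].
  by move=> c x Ux; apply: cvgV; [exact: g0|exact: c].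
move=> /[dup] /CkS Cg [d D]; split=> [x Ux|v].
  by apply: differentiableV; [exact: d|exact: g0].
have Ci := IH Cg.
apply: (Ck_congr _ (CkM (CkM (@Ck_cst n _ (-1 : R)) (CkM Ci Ci)) (D v))).
move=> x; rewrite inE => Ux.
rewrite deriveV ?g0 //; last by apply: diff_derivable; exact: d.
by rewrite mulN1r -expr2 exprVn.
Qed.

(** The derivative (2 sqrt g)^-1 Dg involves sqrt g again, which is of class C^n
    by induction. *)
Lemma Ck_sqrt n g : (forall x, U x -> 0 < g x) -> Ck n U g ->
  Ck n U (fun x => Num.sqrt (g x)).
Proof.
move=> g0.
have s0 x : U x -> 2 * Num.sqrt (g x) != 0.
  by move=> /g0 gx; rewrite mulf_neq0 ?pnatr_eq0 // gt_eqF // sqrtr_gt0.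
elim: n => [|n IH].
  by move=> c x Ux; apply: continuous_comp; [exact: c|exact: sqrt_continuous].
move=> /[dup] /CkS Cg [d D].
have dS x : U x -> differentiable (Num.sqrt : R -> R) (g x).
  by move=> Ux; apply/derivable1_diffP; have [] := is_derive1_sqrt (g0 x Ux).
split=> [x Ux|v].
  by apply: differentiable_comp; [exact: d|exact: dS].
apply: (Ck_congr _ (CkM (CkV s0 (CkM (@Ck_cst n _ (2 : R)) (IH Cg))) (D v))).
move=> x; rewrite inE => Ux.
rewrite !deriveE; try exact: d; last by apply: differentiable_comp; auto.
rewrite [in RHS](diff_comp (d x Ux) (dS x Ux)) /= diff1E; last exact: dS.
by rewrite derive1E derive_sqrt ?g0 // mulrC.
Qed.

Lemma CkN n g : Ck n U g -> Ck n U (fun x => - g x).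
Proof.
move=> Cg; apply: (Ck_congr _ (CkM (@Ck_cst n _ (-1 : R)) Cg)) => x _.
by rewrite mulN1r.
Qed.

Lemma Ck_sum n (W : normedModType R) (I : finType) (F : I -> V -> W) :
  (forall i, Ck n U (F i)) -> Ck n U (fun x => \sum_i F i x).
Proof.
move=> CF; suff Cr r : Ck n U (fun x => \sum_(i <- r) F i x) by exact: Cr.
elim: r => [|i r IH].
  by apply: (Ck_congr _ (@Ck_cst n _ (0 : W))) => x _; rewrite big_nil.
apply: (Ck_congr _ (CkD (CF i) IH)) => x _.
by rewrite big_cons.
Qed.

End SmoothCalculus.

Lemma Ck_coord (R : realType) d (U : set 'rV[R]_d) n k :
  open U -> Ck n U (fun x : 'rV[R]_d => x 0 k : R).
Proof.
move=> Uo; case: n => [|n]; first by move=> x _; exact: coord_continuous.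
split=> [x _|v]; first exact: differentiable_coord.
apply: (Ck_congr Uo _ (Ck_cst Uo n (v 0 k : R))) => x _.
have /matrixP/(_ 0 k) := derive_mx (@derivable_id R 'rV[R]_d x v).
by rewrite derive_id mxE.
Qed.

Lemma is_derive_coord (R : realType) d (x u : 'rV[R]_d) k :
  is_derive x u (fun y : 'rV[R]_d => y 0 k : R) (u 0 k).
Proof.
apply: DeriveDef; first by apply: diff_derivable; exact: differentiable_coord.
have /matrixP/(_ 0 k) := derive_mx (@derivable_id R 'rV[R]_d x u).
by rewrite derive_id mxE.
Qed.

(** * Locally constant and stationary functions *)

Section LocallyConstant.
Context {R : realType}.

(** Mean value theorem along the segments of a small ball. *)
Lemma derive0_locally_cst (V : normedModType R) (U : set V) (g : V -> R) x :
  open U -> U x -> (forall y, U y -> differentiable g y) ->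
  (forall y v, U y -> 'D_v g y = 0) -> \forall y \near x, g y = g x.
Proof.
move=> Uo Ux dg g0.
have /nbhs_ballP[e e0 eU] : nbhs x U by exact: open_nbhs_nbhs.
apply/nbhs_ballP; exists e => // y xy.
pose l (s : R) := s *: (y - x) + x.
have lU (s : R) : 0 <= s <= 1 -> U (l s).
  move=> /andP[s0 s1]; apply: eU; move: xy; rewrite -!ball_normE /= /l.
  rewrite ![`|x - _|]distrC addrK normrZ ger0_norm //.
  by apply: le_lt_trans; rewrite ler_piMl.
have dl (s : R) : is_diff s l ( *:%R^~ (y - x)).
  by apply: is_diff_eq; rewrite addr0.
have dh (s : R) : 0 <= s <= 1 -> is_derive s 1 (g \o l) 0.
  move=> /lU lsU; have dgl := dg _ lsU; apply: DeriveDef.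
    by apply/diff_derivable/differentiable_comp.
  rewrite deriveE; last exact: differentiable_comp.
  by rewrite diff_comp //= diff_val scale1r -deriveE // g0.
have [||c _] := @MVT_segment R (g \o l) (fun=> 0) 0 1 ler01.
- by move=> s; rewrite in_itv /= => /andP[/ltW ? /ltW ?]; apply: dh; apply/andP.
- apply: derivable_within_continuous => s; rewrite in_itv /= => s01.
  by have [] := dh s s01.
by rewrite mul0r /= /l scale1r scale0r add0r subrK => /eqP; rewrite subr_eq0 => /eqP.
Qed.

Lemma near_sign (V : normedModType R) (h : V -> R) x :
  {for x, continuous h} -> h x != 0 -> \forall y \near x, (0 < h y) = (0 < h x).
Proof.
move=> c; rewrite neq_lt => /orP[lt0|gt0]; near=> y.
  rewrite (lt_gtF lt0) lt_gtF //; near: y; exact: (cvgr_lt _ c _ lt0).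
rewrite gt0; near: y; exact: (cvgr_gt _ c _ gt0).
Unshelve. all: by end_near. Qed.

(** The level set of [g] through [a] and its complement are both open in the
    manifold topology. *)
Lemma atlas_connected_cst (E : normedModType R) (T : Type) k (N : set E)
    (U : nat -> set 'rV[R]_k) (phi : nat -> 'rV[R]_k -> E) (g : E -> T) :
  immersed_atlas N U phi -> atlas_connected N U phi ->
  (forall i x, U i x -> \forall y \near x, g (phi i y) = g (phi i x)) ->
  forall a b, N a -> N b -> g a = g b.
Proof.
move=> atl [_ conn] gcst a b Na Nb.
have Nphi i x : U i x -> N (phi i x).
  by move=> Ux; rewrite -(atlas_cover atl); exists i => //; exists x.
have atlP (P : set T) : atlas_open_set N U phi (N `&` g @^-1` P).
  split=> [|i]; first exact: subIsetl.
  rewrite openE => x [Ux [_ Px]]; rewrite /interior; near=> y.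
  have Uy : U i y by near: y; apply: open_nbhs_nbhs; split=> //; exact: (atlas_open atl).
  split=> //; split; first exact: Nphi.
  by rewrite /preimage /= (_ : g (phi i y) = g (phi i x)) //; near: y; exact: gcst.
have [||A0|B0] := conn _ _ (atlP [set t | t = g a]) (atlP [set t | t <> g a]).
- rewrite -setIUr; apply/setIidPl => c _; rewrite /preimage /=.
  exact: EM.
- by apply/seteqP; split=> // c [[_ /= gc] [_ /= gc']].
- by have : set0 a by rewrite -A0.
by apply: contrapT => gab; have : set0 b; [rewrite -B0; split=> // /esym|].
Unshelve. all: by end_near. Qed.

End LocallyConstant.

Section Stationary.
Context {R : realType} {V : normedModType R}.
Variables (x u : V).
Implicit Types f g : V -> R.

(** To show that a differential is injective at [x], one takes [u] in its kernel
    and shows that the coordinates, being functions of stationary functions, are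
    stationary in the direction [u]. *)
Definition stationary f := is_derive x u f 0.

Lemma stationary_cst (c : R) : stationary (fun=> c).
Proof. exact: is_derive_cst. Qed.

Lemma stationaryD f g : stationary f -> stationary g -> stationary (fun y => f y + g y).
Proof. by move=> Sf Sg; apply: is_derive_eq (is_deriveD Sf Sg) _; rewrite addr0. Qed.

Lemma stationaryN f : stationary f -> stationary (fun y => - f y).
Proof. by move=> Sf; apply: is_derive_eq (is_deriveN Sf) _; rewrite oppr0. Qed.

Lemma stationaryM f g : stationary f -> stationary g -> stationary (fun y => f y * g y).
Proof.
by move=> Sf Sg; apply: is_derive_eq (is_deriveM Sf Sg) _; rewrite !scaler0 addr0.
Qed.

Lemma stationaryV f : f x != 0 -> stationary f -> stationary (fun y => (f y)^-1).
Proof.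
move=> fx0 [df f0]; apply: DeriveDef; first exact: derivableV.
by rewrite deriveV // f0 scaler0.
Qed.

Lemma stationary_sum (I : finType) (F : I -> V -> R) :
  (forall i, stationary (F i)) -> stationary (fun y => \sum_i F i y).
Proof.
move=> SF; suff Sr r : stationary (fun y => \sum_(i <- r) F i y) by exact: Sr.
elim: r => [|i r IH].
  rewrite (_ : (fun y => _) = fun=> 0); first exact: stationary_cst.
  by apply/funext => y; rewrite big_nil.
rewrite (_ : (fun y => _) = fun y => F i y + \sum_(j <- r) F j y); first exact: stationaryD.
by apply/funext => y; rewrite big_cons.
Qed.

Lemma stationary_line f : (forall h : R, f (h *: u + x) = f x) -> stationary f.
Proof.
move=> fl; have e : (fun h : R => h^-1 *: (f (h *: u + x) - f x)) = fun=> 0.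
  by apply/funext => h; rewrite fl subrr scaler0.
apply: DeriveDef; last by rewrite /derive e; apply: lim_cst.
by rewrite /derivable e; apply: is_cvg_cst.
Qed.

Lemma stationary_near f g : (\near x, f x = g x) -> stationary f -> stationary g.
Proof. exact: near_eq_is_derive. Qed.

Lemma stationary_proj_of_rot (M : V -> 'M[R]_3) k l :
  (forall p m, stationary (fun y => M y p m)) -> stationary (fun y => proj_of_rot (M y) k l).
Proof.
move=> SM; under eq_fun do rewrite !mxE.
apply: stationaryM; first exact: stationary_cst.
by case: (ord4P k) => ->; case: (ord4P l) => -> /=; repeat first
  [exact: SM | exact: stationary_cst | apply: stationaryD | apply: stationaryN].
Qed.

End Stationary.

(** * Inner product and bracket *)

Section Frames.
Variable R : realType.
Implicit Types (x y z : su2 R) (a w : su2_3 R) (j k p : 'I_3).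

Lemma ipC x y : ip x y = ip y x.
Proof.
have [x0 [x1 [x2 ->]]] := su2_vec_surj x.
have [y0 [y1 [y2 ->]]] := su2_vec_surj y.
by rewrite !ip_vec; ring.
Qed.

Lemma ipDr x y z : ip x (y + z) = ip x y + ip x z.
Proof.
have [x0 [x1 [x2 ->]]] := su2_vec_surj x.
have [y0 [y1 [y2 ->]]] := su2_vec_surj y.
have [z0 [z1 [z2 ->]]] := su2_vec_surj z.
by rewrite su2_vecD !ip_vec; ring.
Qed.

Lemma ipZr (c : R) x y : ip x (c *: y) = c * ip x y.
Proof.
have [x0 [x1 [x2 ->]]] := su2_vec_surj x.
have [y0 [y1 [y2 ->]]] := su2_vec_surj y.
by rewrite su2_vecZ !ip_vec; ring.
Qed.

Lemma ipDl x y z : ip (x + y) z = ip x z + ip y z.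
Proof. by rewrite ipC ipDr !(ipC z). Qed.

Lemma ipZl (c : R) x y : ip (c *: x) y = c * ip x y.
Proof. by rewrite ipC ipZr ipC. Qed.

Lemma ipNr x y : ip x (- y) = - ip x y.
Proof. by rewrite -scaleN1r ipZr mulN1r. Qed.

Lemma ipNl x y : ip (- x) y = - ip x y.
Proof. by rewrite ipC ipNr ipC. Qed.

Lemma bracketDl x y z : bracket (x + y) z = bracket x z + bracket y z.
Proof.
have [x0 [x1 [x2 ->]]] := su2_vec_surj x.
have [y0 [y1 [y2 ->]]] := su2_vec_surj y.
have [z0 [z1 [z2 ->]]] := su2_vec_surj z.
by rewrite su2_vecD !bracket_vec su2_vecD; congr su2_vec; ring.
Qed.

Lemma bracketZl (c : R) x y : bracket (c *: x) y = c *: bracket x y.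
Proof.
have [x0 [x1 [x2 ->]]] := su2_vec_surj x.
have [y0 [y1 [y2 ->]]] := su2_vec_surj y.
by rewrite su2_vecZ !bracket_vec su2_vecZ; congr su2_vec; ring.
Qed.

Lemma ip_basis x y : ip x y = \sum_p ip x (su2_basis R p) * ip y (su2_basis R p).
Proof.
have [x0 [x1 [x2 ->]]] := su2_vec_surj x.
have [y0 [y1 [y2 ->]]] := su2_vec_surj y.
by rewrite sum_ord3 !ip_vec /=; ring.
Qed.

Lemma su2_basis_sum x : x = \sum_p ip x (su2_basis R p) *: su2_basis R p.
Proof.
have [x0 [x1 [x2 ->]]] := su2_vec_surj x.
by rewrite sum_ord3 !ip_vec !su2_vecZ !su2_vecD /=; congr su2_vec; ring.
Qed.

Lemma su2_ip_eq x y : (forall p, ip x (su2_basis R p) = ip y (su2_basis R p)) -> x = y.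
Proof.
by move=> e; rewrite (su2_basis_sum x) (su2_basis_sum y); under eq_bigr do rewrite e.
Qed.

Lemma ip_basisE p k : ip (su2_basis R p) (su2_basis R k) = (p == k)%:R.
Proof.
by case: (ord3P p) => ->; case: (ord3P k) => ->; rewrite ip_vec /=; ring.
Qed.

(** Lagrange identity for the cross product. *)
Lemma Cauchy_Schwarz_ip x y : `|ip x y| <= `|x| * `|y|.
Proof.
rewrite [`|x|]/(su2_norm x) [`|y|]/(su2_norm y).
have [x0 [x1 [x2 ->]]] := su2_vec_surj x.
have [y0 [y1 [y2 ->]]] := su2_vec_surj y.
rewrite /su2_norm !ip_vec -!expr2 -sqrtrM ?addr_ge0 ?sqr_ge0 //.
rewrite -sqrtr_sqr ler_sqrt ?mulr_ge0 ?addr_ge0 ?sqr_ge0 // -subr_ge0.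
rewrite (_ : _ - _ = (x0 * y1 - x1 * y0) ^+ 2 + (x1 * y2 - x2 * y1) ^+ 2
    + (x2 * y0 - x0 * y2) ^+ 2); last by ring.
by rewrite !addr_ge0 ?sqr_ge0.
Qed.

Lemma su2_3_eq a w : (forall j, entry a j = entry w j) -> a = w.
Proof.
case: a w => [[a1 a2] a3] [[w1 w2] w3] e.
by have := e 0; have := e 1; have := e 2; rewrite /entry /= => -> -> ->.
Qed.

Lemma entry_incl j k x : entry (incl k x) j = if j == k then x else 0.
Proof. by case: (ord3P j) => ->; case: (ord3P k) => ->. Qed.

Lemma entryD a w j : entry (a + w) j = entry a j + entry w j.
Proof. by case: (ord3P j) => ->. Qed.

Lemma entryZ (c : R) a j : entry (c *: a) j = c *: entry a j.
Proof. by case: (ord3P j) => ->. Qed.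

Lemma entry_sum (I : finType) (F : I -> su2_3 R) j :
  entry (\sum_i F i) j = \sum_i entry (F i) j.
Proof.
elim/big_rec2: _ => [|i x y _ <-]; first by case: (ord3P j) => ->.
by rewrite entryD.
Qed.

Lemma linZ j x (c : R) a : lin j x (c *: a) = c * lin j x a.
Proof. by rewrite /lin entryZ ipZr. Qed.

Lemma lin_sum (I : finType) (F : I -> su2_3 R) j x :
  lin j x (\sum_i F i) = \sum_i lin j x (F i).
Proof. by rewrite [LHS]linear_sum. Qed.

Lemma lin_continuous j x : continuous (lin j x).
Proof.
apply: bounded_linear_continuous; apply/linear_boundedP.
exists `|x|; split; first exact: num_real.
move=> r xr a; rewrite /lin /=; apply: le_trans (Cauchy_Schwarz_ip _ _) _.
apply: ler_pM => //; first exact: ltW.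
case: a => [[a1 a2] a3].
rewrite [leRHS]prod_normE [X in Num.max X]prod_normE.
by case: (ord3P j) => ->; rewrite /entry /= !le_max lexx ?orbT.
Qed.

Lemma lin_differentiable j x a : differentiable (lin j x) a.
Proof. exact/linear_differentiable/lin_continuous. Qed.

Lemma derive_lin (V : normedModType R) (phi : V -> su2_3 R) j x (y v : V) :
  differentiable phi y -> is_derive y v (lin j x \o phi) (lin j x ('d phi y v)).
Proof.
move=> dphi; have dl := lin_differentiable j x (phi y).
apply: DeriveDef; first exact/diff_derivable/differentiable_comp.
rewrite deriveE; last exact: differentiable_comp.
by rewrite diff_comp // diff_lin //; exact: lin_continuous.
Qed.

End Frames.

(** Turns an identity between inner products into a polynomial identity. *)
Ltac gen_ip := repeat match goal with
  |- context [ip ?a ?b] => let t := fresh "t" in set t := ip a b; clearbody t end.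

#[local] Opaque bracket ip su2_vec.

(** * The symplectic distribution *)

Section Distribution.
Variable R : realType.
Implicit Types (x y z xi zeta : su2 R) (a w v : su2_3 R) (j k p : 'I_3).

(** The vector pi1^sharp of [lin j xi].  For [j = 0] it is an infinitesimal
    rotation of the three vectors. *)
Definition sharp_lin a j xi : su2_3 R :=
  let b := (Phi a)^-1 *: (ip (bracket a.1.1 a.1.2) xi *: bracket a.1.1 a.1.2
    + ip (bracket a.1.2 a.2) xi *: bracket a.1.2 a.2
    + ip (bracket a.2 a.1.1) xi *: bracket a.2 a.1.1) in
  match val j with
  | 0 => (bracket a.1.1 xi, bracket a.1.2 xi, bracket a.2 xi)
  | 1 => (bracket a.1.2 xi, bracket xi a.1.1, b)
  | _ => (bracket a.2 xi, - b, bracket xi a.1.1)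
  end.

(** Invariance of the inner product, <zeta, [x, xi]> = <[xi, zeta], x>, moves
    [xi] out of the bracket. *)
Lemma lin_sharp_lin a j k xi zeta :
  lin k zeta (sharp_lin a j xi) = bracket_lin a j k xi zeta.
Proof.
have jacobi x : ip zeta (bracket x xi) = ip (bracket xi zeta) x.
  have [x0 [x1 [x2 ->]]] := su2_vec_surj x.
  have [y0 [y1 [y2 ->]]] := su2_vec_surj xi.
  have [z0 [z1 [z2 ->]]] := su2_vec_surj zeta.
  by rewrite !bracket_vec !ip_vec; ring.
have jacobiN x : ip zeta (bracket xi x) = - ip (bracket xi zeta) x.
  have [x0 [x1 [x2 ->]]] := su2_vec_surj x.
  have [y0 [y1 [y2 ->]]] := su2_vec_surj xi.
  have [z0 [z1 [z2 ->]]] := su2_vec_surj zeta.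
  by rewrite !bracket_vec !ip_vec; ring.
have bE (u v w : su2 R) : ip zeta (ip u xi *: u + ip v xi *: v + ip w xi *: w) =
    ip u xi * ip u zeta + ip v xi * ip v zeta + ip w xi * ip w zeta.
  by rewrite !ipDr !ipZr !(ipC zeta).
by case: (ord3P j) => ->; case: (ord3P k) => ->;
  rewrite /lin /bracket_lin /lin /sharp_lin /entry /Aform /=;
  rewrite ?(ipNr, ipZr, jacobi, jacobiN, bE).
Qed.

Lemma sharp_lin0 a j : sharp_lin a j 0 = 0.
Proof.
apply: su2_3_eq => k; apply: su2_ip_eq => q; rewrite !(ipC _ (su2_basis R q)).
rewrite -!/(lin k (su2_basis R q) _) lin_sharp_lin linear0.
have b0 y : bracket 0 y = 0 :> su2 R by rewrite -(scale0r y) bracketZl !scale0r.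
have i0 y : ip 0 y = 0 :> R by rewrite -(scale0r y) ipZl mul0r.
have [[d [u E]]|[d [u [u' [u'' E]]]]] := bracket_linP a j k; rewrite E.
  by rewrite b0 i0 mulr0.
by rewrite ![ip _ 0]ipC !i0 !mul0r !addr0 mulr0.
Qed.

Lemma su2_3_sum a : a = \sum_j \sum_p lin j (su2_basis R p) a *: incl j (su2_basis R p).
Proof.
apply: su2_3_eq => k; rewrite entry_sum (bigD1 k) //= [X in _ + X]big1 ?addr0 => [|j jk].
  rewrite entry_sum [LHS]su2_basis_sum; apply: eq_bigr => p _.
  by rewrite entryZ entry_incl eqxx /lin ipC.
rewrite entry_sum big1 // => p _.
by rewrite entryZ entry_incl eq_sym (negPf jk) scaler0.
Qed.

(** A linear form is the sum over [j] of [lin j] of its partial gradients, so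
    its sharp is the sum of the sharps of these. *)
Lemma pi1_sharp a (alpha beta : {linear su2_3 R -> R^o}) :
  pi1 a alpha beta = beta (\sum_j sharp_lin a j
    (\sum_p alpha (incl j (su2_basis R p)) *: su2_basis R p)).
Proof.
have sharp_sum j (c : 'I_3 -> R) (x : 'I_3 -> su2 R) :
    sharp_lin a j (\sum_p c p *: x p) = \sum_p c p *: sharp_lin a j (x p).
  apply: su2_3_eq => k; apply: su2_ip_eq => q; rewrite !(ipC _ (su2_basis R q)).
  rewrite -!/(lin k (su2_basis R q) _) lin_sum lin_sharp_lin.
  under [RHS]eq_bigr do rewrite linZ lin_sharp_lin.
  have [[d [u E]]|[d [u [u' [u'' E]]]]] := bracket_linP a j k; rewrite E !sum_ord3 !E.
    rewrite !(bracketDl, bracketZl, ipDl, ipZl).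
    by gen_ip; ring.
  rewrite !(ipDr, ipZr).
  by gen_ip; ring.
rewrite linear_sum /=; apply: eq_bigr => j _.
rewrite sharp_sum linear_sum /=; apply: eq_bigr => p _.
rewrite linearZ /= [in RHS](su2_3_sum (sharp_lin _ _ _)) linear_sum scaler_sumr.
apply: eq_bigr => k _; rewrite linear_sum scaler_sumr; apply: eq_bigr => q _.
by rewrite linearZ /= lin_sharp_lin /GRing.scale /= -mulrA [X in _ * X]mulrC.
Qed.

(** The derivative in the direction [w] of the inner product of [entry a j] and
    [entry a k]. *)
Definition dgram a w j k := ip (entry a j) (entry w k) + ip (entry w j) (entry a k).

(** The kernel of the differential of [f_map] at [a]: the components of [f_map]
    are the off-diagonal inner products and the differences of the diagonal
    ones. *)
Definition gram_tangent a : set (su2_3 R) :=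
  [set w | exists t, forall j k, dgram a w j k = t *+ (j == k)].

Lemma gram_tangentD a v w :
  gram_tangent a v -> gram_tangent a w -> gram_tangent a (v + w).
Proof.
move=> [t vt] [s ws]; exists (t + s) => j k.
by rewrite mulrnDl -vt -ws /dgram !entryD !(ipDl, ipDr); gen_ip; ring.
Qed.

Lemma gram_tangentZ a (c : R) v : gram_tangent a v -> gram_tangent a (c *: v).
Proof.
move=> [t vt]; exists (c * t) => j k.
by rewrite -mulrnAr -vt /dgram !entryZ !(ipZl, ipZr); gen_ip; ring.
Qed.

Lemma gram_tangent_sharp a j xi : Phi a != 0 -> gram_tangent a (sharp_lin a j xi).
Proof.
case: a => [[a b] c].
have [a0 [a1 [a2 ->]]] := su2_vec_surj a.
have [b0 [b1 [b2 ->]]] := su2_vec_surj b.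
have [c0 [c1 [c2 ->]]] := su2_vec_surj c.
have [x0 [x1 [x2 ->]]] := su2_vec_surj xi.
rewrite /Phi /= !bracket_vec !ip_vec => nz.
(* The common change of the three squared lengths; rotations leave them fixed.
   *)
exists (match val j with
  | 0 => 0
  | 1 => 2 * ip (su2_vec a0 a1 a2) (bracket (su2_vec b0 b1 b2) (su2_vec x0 x1 x2))
  | _ => 2 * ip (su2_vec a0 a1 a2) (bracket (su2_vec c0 c1 c2) (su2_vec x0 x1 x2)) end).
move=> k l.
by case: (ord3P j) => ->; case: (ord3P k) => ->; case: (ord3P l) => ->;
  rewrite /dgram /entry /sharp_lin /= /Phi /=
    ?(bracket_vec, ip_vec, su2_vecZ, su2_vecD, ipNl, ipNr) /=; field.
Qed.

(** Cramer rule for three vectors with nonzero triple product. *)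
Lemma ip_frame_eq0 a x : Phi a != 0 -> (forall k, ip x (entry a k) = 0) -> x = 0.
Proof.
move=> a0 xa; have := xa 0; have := xa 1; have := xa 2; move: a0 {xa}.
case: a => [[a b] c]; rewrite /Phi /entry /=.
have [a0 [a1 [a2 ->]]] := su2_vec_surj a.
have [b0 [b1 [b2 ->]]] := su2_vec_surj b.
have [c0 [c1 [c2 ->]]] := su2_vec_surj c.
have [x0 [x1 [x2 ->]]] := su2_vec_surj x.
rewrite !bracket_vec !ip_vec; set D := (X in X != 0) => D0 xc xb xa.
have -> : (0 : su2 R) = su2_vec 0 0 0.
  by have := su2_vecZ 0 0 0 (0 : R); rewrite scale0r !mul0r.
have e0 : D * x0 = 0.
  rewrite (_ : _ * _ = (b1 * c2 - b2 * c1) * (x0 * a0 + x1 * a1 + x2 * a2)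
      + (c1 * a2 - c2 * a1) * (x0 * b0 + x1 * b1 + x2 * b2)
      + (a1 * b2 - a2 * b1) * (x0 * c0 + x1 * c1 + x2 * c2)); last by rewrite /D; ring.
  by rewrite xa xb xc !mulr0 !addr0.
have e1 : D * x1 = 0.
  rewrite (_ : _ * _ = (b2 * c0 - b0 * c2) * (x0 * a0 + x1 * a1 + x2 * a2)
      + (c2 * a0 - c0 * a2) * (x0 * b0 + x1 * b1 + x2 * b2)
      + (a2 * b0 - a0 * b2) * (x0 * c0 + x1 * c1 + x2 * c2)); last by rewrite /D; ring.
  by rewrite xa xb xc !mulr0 !addr0.
have e2 : D * x2 = 0.
  rewrite (_ : _ * _ = (b0 * c1 - b1 * c0) * (x0 * a0 + x1 * a1 + x2 * a2)
      + (c0 * a1 - c1 * a0) * (x0 * b0 + x1 * b1 + x2 * b2)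
      + (a0 * b1 - a1 * b0) * (x0 * c0 + x1 * c1 + x2 * c2)); last by rewrite /D; ring.
  by rewrite xa xb xc !mulr0 !addr0.
by move: e0 e1 e2 => /eqP + /eqP + /eqP; rewrite !mulf_eq0 (negPf D0) /= => /eqP-> /eqP-> /eqP->.
Qed.

#[local] Opaque entry.

(** The first functional makes the multiple of the identity vanish.  Then W^T A
    is antisymmetric, so the other three determine it, and A is invertible.  In
    particular the kernel has dimension at most four. *)
Lemma gram_tangent_eq0 a w : Phi a != 0 -> gram_tangent a w ->
  ip (entry w 0) (entry a 0) = 0 -> ip (entry w 0) (entry a 1) = 0 ->
  ip (entry w 1) (entry a 2) = 0 -> ip (entry w 2) (entry a 0) = 0 -> w = 0.
Proof.
move=> a0 [t wt] w00 w01 w12 w20.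
have t0 : t = 0.
  by have := wt 0 0; rewrite /dgram ipC w00 addr0 => ->.
have w0 j k : ip (entry w j) (entry a k) = - ip (entry w k) (entry a j).
  have := wt j k; rewrite /dgram t0 mul0rn [X in X + _]ipC => /eqP.
  by rewrite addrC addr_eq0 => /eqP.
have w11 : ip (entry w 1) (entry a 1) = 0 by have := w0 1 1; gen_ip; lra.
have w22 : ip (entry w 2) (entry a 2) = 0 by have := w0 2 2; gen_ip; lra.
apply: su2_3_eq => j; rewrite [RHS](_ : _ = 0); last first.
  by rewrite -(scale0r (0 : su2_3 R)) entryZ scale0r.
apply: (ip_frame_eq0 a0) => k.
case: (ord3P j) => ->; case: (ord3P k) => ->.
- exact: w00.
- exact: w01.
- by rewrite w0 w20 oppr0.
- by rewrite w0 w01 oppr0.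
- exact: w11.
- exact: w12.
- exact: w20.
- by rewrite w0 w12 oppr0.
- exact: w22.
Qed.

#[local] Transparent entry.

(** A kernel vector [w] is the sum of an infinitesimal rotation and of a
    multiple c of V_0 = pi1^sharp (lin 1 a_3).  The witnesses c and [xi] below
    are found by matching the four functionals of [gram_tangent_eq0]. *)
Lemma symplectic_distributionE a : Phi a != 0 ->
  symplectic_distribution a = gram_tangent a.
Proof.
move=> a0; apply/seteqP; split=> [v [alpha av]|w wa].
  have -> : v = \sum_j sharp_lin a j
      (\sum_p alpha (incl j (su2_basis R p)) *: su2_basis R p).
    apply: su2_3_eq => k; apply: su2_ip_eq => q; rewrite !(ipC _ (su2_basis R q)).
    have := av (lin k (su2_basis R q)).
    by rewrite pi1_sharp.
  rewrite sum_ord3; apply: gram_tangentD; last exact: gram_tangent_sharp.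
  by apply: gram_tangentD; exact: gram_tangent_sharp.
pose c := (Phi a)^-1 * ip (entry w 0) (entry a 0).
pose xi := - (Phi a)^-1 *: (ip (entry w 0) (entry a 1) *: entry a 2
  + ip (entry w 1) (entry a 2) *: entry a 0 + ip (entry w 2) (entry a 0) *: entry a 1).
pose alpha : {linear su2_3 R -> R^o} := lin 0 xi \+ lin 1 (c *: entry a 2).
pose v : su2_3 R := sharp_lin a 0 xi + sharp_lin a 1 (c *: entry a 2).
have piE beta : pi1 a alpha beta = beta v.
  rewrite pi1_sharp sum_ord3; congr (beta _).
  have gradE j : \sum_p alpha (incl j (su2_basis R p)) *: su2_basis R p =
      (if j == 0 then xi else 0) + (if j == 1 then c *: entry a 2 else 0).
    rewrite [RHS]su2_basis_sum; apply: eq_bigr => p _; congr (_ *: _).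
    rewrite /alpha /= !lin_incl ipDl.
    have ip0 y : ip 0 y = 0 :> R by rewrite -(scale0r y) ipZl mul0r.
    by rewrite ![_ == j]eq_sym; congr (_ + _); case: ifP; rewrite ?ip0.
  by rewrite !gradE /= addr0 add0r addr0 sharp_lin0 addr0.
suff -> : w = v by exists alpha => beta; rewrite piE.
apply/eqP; rewrite -subr_eq0; apply/eqP; apply: (gram_tangent_eq0 a0).
- rewrite -scaleN1r; apply: gram_tangentD => //; apply: gram_tangentZ.
  by apply: gram_tangentD; apply: gram_tangent_sharp.
all: rewrite -scaleN1r entryD entryZ ipDl ipZl mulN1r /v entryD ipDl /xi /c.
all: move: (ip (entry w 0) (entry a 0)) (ip (entry w 0) (entry a 1))
  (ip (entry w 1) (entry a 2)) (ip (entry w 2) (entry a 0)) => s t u r.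
all: move: a0; clear; case: a => [[a b] c]; rewrite /sharp_lin /entry /Phi /=.
all: have [a0 [a1 [a2 ->]]] := su2_vec_surj a.
all: have [b0 [b1 [b2 ->]]] := su2_vec_surj b.
all: have [c0 [c1 [c2 ->]]] := su2_vec_surj c.
all: rewrite ?(bracket_vec, ip_vec, su2_vecZ, su2_vecD).
all: by move=> D0; field.
Qed.

End Distribution.

(** * Triples of vectors as matrices *)

Section Matrices.
Variable R : realType.
Implicit Types (a b : su2_3 R) (M : 'M[R]_3) (j k p : 'I_3).

Definition frame_mx a : 'M[R]_3 := \matrix_(p, j) lin j (su2_basis R p) a.
Definition mx_frame M : su2_3 R := \sum_j \sum_p M p j *: incl j (su2_basis R p).

Lemma frame_mxK : cancel frame_mx mx_frame.
Proof.
move=> a; rewrite [RHS]su2_3_sum; apply: eq_bigr => j _; apply: eq_bigr => p _.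
by rewrite mxE.
Qed.

Lemma lin_mx_frame j p M : lin j (su2_basis R p) (mx_frame M) = M p j.
Proof.
rewrite /mx_frame lin_sum (bigD1 j) //= [X in _ + X]big1 ?addr0 => [|k kj].
  rewrite lin_sum (bigD1 p) //= [X in _ + X]big1 ?addr0 => [|q qp].
    by rewrite linZ lin_incl eqxx ip_basisE eqxx mulr1.
  by rewrite linZ lin_incl eqxx ip_basisE eq_sym (negPf qp) mulr0.
by rewrite lin_sum big1 // => q _; rewrite linZ lin_incl eq_sym (negPf kj) mulr0.
Qed.

Lemma mx_frameK : cancel mx_frame frame_mx.
Proof. by move=> M; apply/matrixP => p j; rewrite mxE lin_mx_frame. Qed.

Lemma gram_mx a b j k : ((frame_mx a)^T *m frame_mx b) j k = ip (entry a j) (entry b k).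
Proof.
rewrite mxE [RHS]ip_basis; apply: eq_bigr => p _.
by rewrite !mxE /lin ![ip (su2_basis R p) _]ipC.
Qed.

Lemma Phi_det3 a : Phi a = det3 (frame_mx a).
Proof.
case: a => [[a b] c]; rewrite /det3 !mxE /lin /entry /Phi /=.
have [a0 [a1 [a2 ->]]] := su2_vec_surj a.
have [b0 [b1 [b2 ->]]] := su2_vec_surj b.
have [c0 [c1 [c2 ->]]] := su2_vec_surj c.
by rewrite bracket_vec !ip_vec /=; ring.
Qed.

Definition gram a j k := ip (entry a j) (entry a k).

Lemma gramC a j k : gram a j k = gram a k j.
Proof. exact: ipC. Qed.

Lemma f_mapE a : f_map a = \row_(i < 5) nth 0 [:: gram a 0 1; gram a 1 2; gram a 2 0;
  gram a 0 0 - gram a 1 1; gram a 1 1 - gram a 2 2] i.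
Proof. by []. Qed.

(** The shift is the difference of the first diagonal entries. *)
Lemma f_map_gram a b : f_map a = f_map b <->
  exists t, forall j k, gram a j k = gram b j k + t *+ (j == k).
Proof.
rewrite !f_mapE; move: (@gramC a) (@gramC b); move: (gram a) (gram b) => A B sA sB.
split=> [/rowP e|[t e]].
  exists (A 0 0 - B 0 0) => j k.
  have := e 0; have := e 1; have := e 2; have := e 3; have := e 4.
  rewrite !mxE /= => e4 e3 e2 e1 e0.
  by case: (ord3P j) => ->; case: (ord3P k) => ->; rewrite /= ?mulr0n ?addr0 ?mulr1n //;
    do ?[by rewrite sA sB]; lra.
by apply/rowP => i; rewrite !mxE !e /= !addr0 !mulr1n ![_ + t - _]addrAC;
  congr (nth _ [:: _; _; _; _; _] _); ring.
Qed.

End Matrices.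

Section GramDerivative.
Context {R : realType} {V : normedModType R}.
Variables (phi : V -> su2_3 R) (x : V).
Hypothesis dphi : differentiable phi x.

Lemma gram_differentiable j k :
  differentiable (fun y => ip (entry (phi y) j) (entry (phi y) k)) x.
Proof.
rewrite (_ : (fun y => _) = \sum_p
   ((lin j (su2_basis R p) \o phi : V -> R) * (lin k (su2_basis R p) \o phi : V -> R))).
  apply: differentiable_sum => p; apply: differentiableM;
    exact: (differentiable_comp dphi (lin_differentiable _ _ _)).
apply/funext => y; rewrite fct_sumE ip_basis; apply: eq_bigr => p _.
by rewrite /lin !fctE /= ![ip (su2_basis R p) _]ipC.
Qed.

Lemma gram_derive j k v :
  is_derive x v (fun y => ip (entry (phi y) j) (entry (phi y) k))
    (dgram (phi x) ('d phi x v) j k).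
Proof.
rewrite (_ : (fun y => _) = \sum_p
   ((lin j (su2_basis R p) \o phi : V -> R) * (lin k (su2_basis R p) \o phi : V -> R))); last first.
  apply/funext => y; rewrite fct_sumE ip_basis; apply: eq_bigr => p _.
  by rewrite /lin !fctE /= ![ip (su2_basis R p) _]ipC.
have D j' p := derive_lin j' (su2_basis R p) v dphi.
have DM p := is_deriveM (D j p) (D k p).
apply: is_derive_eq (is_derive_sum DM) _.
rewrite /dgram !ip_basis -big_split; apply: eq_bigr => p _ /=.
rewrite /lin /GRing.scale /= ![ip (su2_basis R p) _]ipC.
by congr (_ + _); exact: mulrC.
Qed.

End GramDerivative.

(** * Charts of a fibre *)

Section Charts.
Variable R : realType.
Variables (eta : su2_3 R) (sg : R).
Hypothesis sg2 : sg * sg = 1.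
Implicit Types (i j : 'I_4) (x y : 'rV[R]_4).

Local Notation s j k := (ip (entry eta j) (entry eta k)).
Definition leaf_minor1 := minor1 (s 0 0).
Definition leaf_minor2 := minor2 (s 0 0) (s 1 1) (s 0 1).
Definition leaf_minor3 := minor3 (s 0 0) (s 1 1) (s 2 2) (s 0 1) (s 0 2) (s 1 2).
Definition leaf_posdef := posdef (s 0 0) (s 1 1) (s 2 2) (s 0 1) (s 0 2) (s 1 2).
Definition leaf_chol := chol sg (s 0 0) (s 1 1) (s 2 2) (s 0 1) (s 0 2) (s 1 2).

(** Slot [i] of the affine chart q_i = 1 is free in [x], and is used to store t.
    *)
Definition quat i x : 'I_4 -> R := fun k => if k == i then 1 else x 0 k.
Definition chart i x : su2_3 R := mx_frame (quat_rot (quat i x) *m leaf_chol (x 0 i)).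
Definition chart_dom i : set 'rV[R]_4 := [set x | leaf_posdef (x 0 i)].
(** Homogeneous coordinates are rescaled so that slot [j] becomes 1, and t moves
    from slot [i] to slot [j]. *)
Definition chart_change i j x : 'rV[R]_4 :=
  \row_k if k == j then x 0 i else quat i x k / quat i x j.

(** [sg] is meant to be 1 or -1, the sign of [Phi] on the set. *)
Definition fibre : set (su2_3 R) :=
  (@f_map R @^-1` [set f_map eta]) `&` [set a | 0 < sg * Phi a].

Lemma fibreP a : fibre a <-> 0 < sg * Phi a /\ exists t,
  (frame_mx a)^T *m frame_mx a = shifted_gram (s 0 0) (s 1 1) (s 2 2) (s 0 1) (s 0 2) (s 1 2) t.
Proof.
split=> [[/f_map_gram[t e] a0]|[a0 [t /matrixP e]]]; split=> //.
  exists t; apply/matrixP => j k; rewrite gram_mx -/(gram a j k) e mxE.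
  by case: (ord3P j) => ->; case: (ord3P k) => ->; rewrite /= ?addr0 // /gram ipC.
apply/f_map_gram; exists t => j k; rewrite /gram -gram_mx e mxE.
by case: (ord3P j) => ->; case: (ord3P k) => ->; rewrite /= ?addr0 // /gram ipC.
Qed.

Lemma quat_sqnorm_chart_gt0 i x : 0 < quat_sqnorm (quat i x).
Proof. by apply: (@quat_sqnorm_gt0 _ _ i); rewrite /quat eqxx. Qed.

Lemma chart_gram i x : chart_dom i x -> (frame_mx (chart i x))^T *m frame_mx (chart i x) =
  shifted_gram (s 0 0) (s 1 1) (s 2 2) (s 0 1) (s 0 2) (s 1 2) (x 0 i).
Proof.
move=> Ux; rewrite mx_frameK trmx_mul mulmxA -[_ *m _ *m quat_rot _]mulmxA.
by rewrite quat_rot_orthogonal ?gt_eqF ?quat_sqnorm_chart_gt0 // mulmx1 chol_gram.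
Qed.

Lemma chart_fibre i x : chart_dom i x -> fibre (chart i x).
Proof.
move=> Ux; apply/fibreP; split; last by exists (x 0 i); exact: chart_gram.
rewrite Phi_det3 mx_frameK det3M quat_rot_det ?gt_eqF ?quat_sqnorm_chart_gt0 // mul1r chol_det //.
by rewrite mulrA sg2 mul1r sqrtr_gt0; case/and3P: Ux.
Qed.

(** The factor Q = A L(t)^-1 is orthogonal because L(t) and A have the same Gram
    matrix; its determinant is 1 because [sg] gives L(t) the sign of det A. *)
Lemma chart_surj a : fibre a -> exists i x, chart_dom i x /\ chart i x = a.
Proof.
move=> /fibreP[a0 [t e]].
have d0 : det3 (frame_mx a) != 0.
  by apply: contraTneq a0 => d0; rewrite Phi_det3 d0 mulr0 ltxx.
have pt : leaf_posdef t := gram_posdef e d0.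
have Lu : leaf_chol t \in unitmx by exact: chol_unit.
have detL : det3 (leaf_chol t) = det3 (frame_mx a).
  rewrite chol_det // (gram_minor3 e) -Phi_det3 sqrtr_sqr.
  have s1 : `|sg| = 1.
    have /eqP : `|sg| ^+ 2 = 1 by rewrite -normrX expr2 sg2 normr1.
    by rewrite sqrp_eq1 // => /eqP.
  by rewrite -[`|Phi a|]mul1r -s1 -normrM gtr0_norm // mulrA sg2 mul1r.
pose M := frame_mx a *m invmx (leaf_chol t).
have aM : frame_mx a = M *m leaf_chol t by rewrite /M mulmxKV.
have MM : M^T *m M = 1%:M.
  rewrite /M trmx_mul mulmxA -[_ *m _ *m frame_mx a]mulmxA e -(chol_gram sg2 pt).
  by rewrite trmx_inv mulmxA mulVmx ?unitmx_tr // mul1mx mulmxV.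
have dM : det3 M = 1.
  by apply: (mulIf d0); rewrite -{1}detL -det3M -aM mul1r.
have [q [m [qm qM]]] := SO3_rot MM dM.
pose x : 'rV[R]_4 := \row_k if k == m then t else q k.
have xm : x 0 m = t by rewrite mxE eqxx.
exists m, x; split; first by rewrite /chart_dom /= xm.
rewrite /chart xm (_ : quat m x = q); last first.
  by apply/funext => k; rewrite /quat mxE; case: eqP => // ->.
by rewrite qM -aM frame_mxK.
Qed.

(** The squared length of the first vector gives t, hence L(t), hence the
    rotation A L(t)^-1, hence the line of the quaternion. *)
Lemma chart_eq i j x y : chart_dom i x -> chart_dom j y -> chart i x = chart j y ->
  x 0 i = y 0 j /\ forall k l, line_proj (quat i x) k l = line_proj (quat j y) k l.
Proof.
move=> Ux Uy e.
have xy : x 0 i = y 0 j.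
  have := chart_gram Uy; rewrite -e chart_gram // => /matrixP/(_ 0 0).
  by rewrite !mxE /= => /addrI.
split=> // k l.
have := can_inj (@mx_frameK R) e; rewrite -xy.
move=> /(congr1 (fun M => M *m invmx (leaf_chol (x 0 i)))).
rewrite !mulmxK ?chol_unit // => /(congr1 (fun M => proj_of_rot M k l)).
by rewrite !proj_of_quat_rot ?gt_eqF ?quat_sqnorm_chart_gt0.
Qed.

(** On the chart the quaternion has coordinate 1 in slot [i], so it is recovered
    from its projection as column [i] divided by the diagonal entry. *)
Lemma chart_inj i : set_inj (chart_dom i) (chart i).
Proof.
move=> x y; rewrite !inE => Ux Uy /(chart_eq Ux Uy) [xy e].
apply/rowP => k; have [->//|ki] := eqVneq k i.
have qi z : line_proj (quat i z) i i = (quat_sqnorm (quat i z))^-1.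
  by rewrite /line_proj /quat eqxx !mul1r.
have qk z : line_proj (quat i z) k i = z 0 k / quat_sqnorm (quat i z).
  by rewrite /line_proj /quat eqxx (negPf ki) mulr1.
have := e k i; have := e i i; rewrite !qi !qk => /invr_inj -> /mulIf; apply.
by rewrite invr_eq0 gt_eqF // quat_sqnorm_chart_gt0.
Qed.

Lemma chart_changeE i j x : quat i x j != 0 -> chart j (chart_change i j x) = chart i x.
Proof.
move=> qj; rewrite /chart mxE eqxx /quat_rot; congr (mx_frame (rot_of_proj _ *m _)).
rewrite (_ : quat _ (chart_change _ _ _) = fun k => (quat i x j)^-1 * quat i x k).
  by rewrite line_proj_scale // invr_eq0.
apply/funext => k; rewrite {1}/quat mxE; case: eqP => [->|_]; first by rewrite mulVf.
by rewrite mulrC.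
Qed.

(** The image of chart [j] is detected by the diagonal entry q_j^2 / |q|^2 of
    the projection onto the line of q; where it does not vanish, [chart_change]
    provides the preimage. *)
Lemma chart_overlap i j : chart_dom i `&` chart i @^-1` (chart j @` chart_dom j) =
  chart_dom i `&` [set x | quat i x j != 0].
Proof.
apply/seteqP; split=> [x [Ux [y Uy /esym e]]|x [Ux /= qj]]; split=> //.
  have yj : line_proj (quat j y) j j = (quat_sqnorm (quat j y))^-1.
    by rewrite /line_proj /quat eqxx !mul1r.
  have [_ /(_ j j)] := chart_eq Ux Uy e; rewrite yj => h; apply/eqP => q0.
  move: h; rewrite /line_proj q0 !mul0r => /esym/eqP.
  by rewrite invr_eq0 gt_eqF // quat_sqnorm_chart_gt0.
exists (chart_change i j x); last exact: chart_changeE.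
by rewrite /chart_dom /= mxE eqxx.
Qed.

End Charts.

Section ChartSmooth.
Variable R : realType.
Variables (eta : su2_3 R) (sg : R).
Implicit Types (i j : 'I_4) (x y : 'rV[R]_4).
Local Notation phi := (chart eta sg).
Local Notation dom := (chart_dom eta).

Ltac ck_with t := repeat first
  [ t | exact: Ck_coord | exact: Ck_cst
  | apply: CkD => // | apply: CkN => // | apply: CkM => //].
Ltac ck := ck_with ltac:(assumption).

Lemma Ck_minor1 n U i : open U -> Ck n U (fun x : 'rV[R]_4 => leaf_minor1 eta (x 0 i)).
Proof. by move=> Uo; rewrite /leaf_minor1 /minor1; ck. Qed.

Lemma Ck_minor2 n U i : open U -> Ck n U (fun x : 'rV[R]_4 => leaf_minor2 eta (x 0 i)).
Proof. by move=> Uo; rewrite /leaf_minor2 /minor2; ck. Qed.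

Lemma Ck_minor3 n U i : open U -> Ck n U (fun x : 'rV[R]_4 => leaf_minor3 eta (x 0 i)).
Proof. by move=> Uo; rewrite /leaf_minor3 /minor3; ck. Qed.

Lemma open_gt0 (g : 'rV[R]_4 -> R) : Ck 0 setT g -> open [set x | 0 < g x].
Proof.
move=> cg; apply: (@open_comp _ _ g [set r | 0 < r]); last exact: open_gt.
by move=> x _; exact: cg.
Qed.

Lemma chart_dom_open i : open (dom i).
Proof.
have -> : dom i = [set x | 0 < leaf_minor1 eta (x 0 i)] `&`
    ([set x | 0 < leaf_minor2 eta (x 0 i)] `&` [set x | 0 < leaf_minor3 eta (x 0 i)]).
  apply/seteqP; split=> x /=; first by move=> /and3P[? ? ?].
  by move=> [? [? ?]]; apply/and3P.
by do 2?apply: openI; apply: open_gt0;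
  [exact: (Ck_minor1 _ _ openT)|exact: (Ck_minor2 _ _ openT)|exact: (Ck_minor3 _ _ openT)].
Qed.

Lemma Ck_quat n U i k : open U -> Ck n U (fun x : 'rV[R]_4 => quat i x k).
Proof. by move=> Uo; rewrite /quat; case: (k == i); ck. Qed.

Lemma Ck_line_proj n U i k l : open U -> Ck n U (fun x : 'rV[R]_4 => line_proj (quat i x) k l).
Proof.
move=> Uo; apply: CkM => //; first by apply: CkM => //; exact: Ck_quat.
apply: CkV => // [x _|]; first by rewrite gt_eqF ?quat_sqnorm_chart_gt0.
by apply: Ck_sum => // m; rewrite /=; apply: CkM => //; exact: Ck_quat.
Qed.

Lemma Ck_rot n U i p m : open U -> Ck n U (fun x : 'rV[R]_4 => quat_rot (quat i x) p m).
Proof.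
move=> Uo; under eq_fun do rewrite mxE.
by case: (ord3P p) => ->; case: (ord3P m) => -> /=; ck_with ltac:(exact: Ck_line_proj).
Qed.

Lemma Ck_chol n i m (j : 'I_3) : Ck n (dom i) (fun x => leaf_chol eta sg (x 0 i) m j).
Proof.
have Uo := @chart_dom_open i.
have C1 : Ck n (dom i) (fun x => Num.sqrt (leaf_minor1 eta (x 0 i))).
  by apply: Ck_sqrt => // [x /and3P[]//|]; exact: Ck_minor1.
have C2 : Ck n (dom i) (fun x => Num.sqrt (leaf_minor2 eta (x 0 i))).
  by apply: Ck_sqrt => // [x /and3P[]//|]; exact: Ck_minor2.
have C3 : Ck n (dom i) (fun x => Num.sqrt (leaf_minor3 eta (x 0 i))).
  by apply: Ck_sqrt => // [x /and3P[]//|]; exact: Ck_minor3.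
(* The entries of the Cholesky factor are quotients by these square roots. *)
have n1 x : dom i x -> Num.sqrt (leaf_minor1 eta (x 0 i)) != 0.
  by move=> /and3P[h _ _]; rewrite gt_eqF ?sqrtr_gt0.
have n2 x : dom i x -> Num.sqrt (leaf_minor2 eta (x 0 i)) != 0.
  by move=> /and3P[_ h _]; rewrite gt_eqF ?sqrtr_gt0.
have V1 := CkV Uo n1 C1; have V2 := CkV Uo n2 C2.
have V12 := CkV Uo (fun x Ux => mulf_neq0 (n1 x Ux) (n2 x Ux)) (CkM Uo C1 C2).
under eq_fun do rewrite mxE.
by case: (ord3P m) => ->; case: (ord3P j) => -> /=; ck => //; exact: Ck_minor1.
Qed.

Lemma Ck_chart n i : Ck n (dom i) (phi i).
Proof.
have Uo := @chart_dom_open i.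
apply: Ck_sum => // j; apply: Ck_sum => // p; apply: CkZl => //.
under eq_fun do rewrite mxE.
by apply: Ck_sum => // m; apply: CkM => //; [exact: Ck_rot|exact: Ck_chol].
Qed.

Lemma chart_overlap_open i j :
  open (dom i `&` [set x | quat i x j != 0]).
Proof.
apply: openI; first exact: chart_dom_open.
apply: (@open_comp _ _ (fun x => quat i x j) [set r | r != 0]); last exact: open_neq.
by move=> x _; apply: (@Ck_quat 0 setT i j openT).
Qed.

Lemma Ck_chart_change n i j :
  Ck n (dom i `&` [set x | quat i x j != 0]) (chart_change i j).
Proof.
have Uo := @chart_overlap_open i j.
apply: (@Ck_congr _ _ _ Uo _ _ (fun x => \sum_k chart_change i j x 0 k *: delta_mx 0 k)) => //.
  by move=> x _; rewrite -row_sum_delta.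
apply: Ck_sum => // k; apply: CkZl => //.
apply: (@Ck_congr _ _ _ Uo _ _
  (fun x => if k == j then x 0 i else quat i x k / quat i x j)).
  by move=> x _; rewrite mxE.
case: (k == j); first exact: Ck_coord.
apply: CkM => //; first exact: Ck_quat.
by apply: CkV => // [x []//|]; exact: Ck_quat.
Qed.

End ChartSmooth.

(** * Integral submanifolds lie in fibres *)

#[local] Opaque Phi f_map.

Section IntegralSubmanifold.
Variable R : realType.
Implicit Types (N : set (su2_3 R)).

Lemma Phi_continuous : continuous (@Phi R).
Proof.
have Uo := @openT (su2_3 R).
have Cdet n : (forall p j, Ck n setT (fun a : su2_3 R => frame_mx a p j)) ->
    Ck n setT (fun a : su2_3 R => det3 (frame_mx a)).
  move=> Cm; rewrite /det3.
  by repeat first [exact: Cm | apply: CkD => // | apply: CkN => // | apply: CkM => //].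
suff C : Ck 0 setT (@Phi R) by move=> a; exact: C.
apply: (@Ck_congr _ _ _ Uo _ _ (fun a => det3 (frame_mx a))).
  by move=> a _; rewrite Phi_det3.
apply: Cdet => p j a _; rewrite (_ : (fun a => _) = lin j (su2_basis R p)).
  exact: lin_continuous.
by apply/funext => b; rewrite mxE.
Qed.

(** In each chart of [N] the components of [f_map] have zero derivative, because
    the tangent spaces of [N] lie in the kernel of its differential; and [Phi]
    does not vanish on [N].  Connectedness then makes [f_map] and the sign of
    [Phi] constant. *)
Lemma integral_submanifold_sub sg (eta : su2_3 R) N : sg != 0 ->
  connected_integral_submanifold (@su2_3_star R) (@symplectic_distribution R) N ->
  N eta -> 0 < sg * Phi eta -> N `<=` fibre eta sg.
Proof.
move=> sg0 [NO [k [U [phi [atl tg conn]]]]] Neta eta0 a Na.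
have NU i x : U i x -> N (phi i x).
  by move=> Ux; rewrite -(atlas_cover atl); exists i => //; exists x.
have Uo := atlas_open atl.
have dphi i x : U i x -> differentiable (phi i) x.
  by have [+ _] := atlas_smooth atl i 1; apply.
have Dphi i x v : U i x -> gram_tangent (phi i x) ('d (phi i) x v).
  move=> Ux; rewrite -symplectic_distributionE; last exact/NO/NU.
  by rewrite -(tg i x Ux); exists v.
split.
  rewrite /preimage /=; apply: (atlas_connected_cst atl conn) => // i x Ux.
  pose G j l y := gram (phi i y) j l.
  have Gd j l y (Uy : U i y) : differentiable (G j l) y by exact/gram_differentiable/dphi.
  have Gv j l y v (Uy : U i y) := gram_derive (dphi i y Uy) j l v.
  have off j l : j != l -> \forall y \near x, G j l y = G j l x.
    move=> jl; apply: (derive0_locally_cst (Uo i) Ux) => [y Uy|y v Uy]; first exact: Gd.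
    have [t /(_ j l) e] := Dphi i y v Uy.
    by rewrite (@derive_val _ _ _ _ _ _ _ (Gv j l y v Uy)) e (negPf jl) mulr0n.
  have dia j l : \forall y \near x, G j j y - G l l y = G j j x - G l l x.
    apply: (derive0_locally_cst (g := G j j - G l l) (Uo i) Ux) => [y Uy|y v Uy].
      by apply: differentiableB; exact: Gd.
    have [t e] := Dphi i y v Uy.
    have Gjj := Gv j j y v Uy; have Gll := Gv l l y v Uy.
    rewrite (@derive_val _ _ _ _ _ _ _ (is_deriveB Gjj Gll)).
    by rewrite !e !eqxx subrr.
  near=> y; rewrite !f_mapE.
  have -> : gram (phi i y) 0 1 = gram (phi i x) 0 1 by near: y; exact: off.
  have -> : gram (phi i y) 1 2 = gram (phi i x) 1 2 by near: y; exact: off.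
  have -> : gram (phi i y) 2 0 = gram (phi i x) 2 0 by near: y; exact: off.
  have -> : gram (phi i y) 0 0 - gram (phi i y) 1 1 = gram (phi i x) 0 0 - gram (phi i x) 1 1.
    by near: y; exact: dia.
  have -> // : gram (phi i y) 1 1 - gram (phi i y) 2 2 = gram (phi i x) 1 1 - gram (phi i x) 2 2.
  by near: y; exact: dia.
rewrite /=; suff -> : (0 < sg * Phi a) = (0 < sg * Phi eta) by [].
apply: (atlas_connected_cst (g := fun a => 0 < sg * Phi a) atl conn) => // i x Ux.
have c0 : {for x, continuous (fun y => Phi (phi i y))}.
  apply: (@continuous_comp _ _ _ (phi i) (@Phi R)); last exact: Phi_continuous.
  exact: differentiable_continuous (dphi i x Ux).
have c : (fun y => sg * Phi (phi i y)) @ x --> sg * Phi (phi i x).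
  exact: (@cvgMl_tmp _ _ _ _ (fun y => Phi (phi i y)) sg _ c0).
have : sg * Phi (phi i x) != 0.
  by apply: mulf_neq0 => //; exact/NO/NU.
exact: (near_sign c).
Unshelve. all: by end_near. Qed.

End IntegralSubmanifold.

(** * The fibre is a leaf *)

Section FibreLeaf.
Variable R : realType.
Variables (eta : su2_3 R) (sg : R).
Hypothesis sg2 : sg * sg = 1.
Hypothesis eta0 : 0 < sg * Phi eta.
Implicit Types (i j : 'I_4) (x y u : 'rV[R]_4).
Local Notation phi := (chart eta sg).
Local Notation dom := (chart_dom eta).
Local Notation leafset := (fibre eta sg).
Local Notation L := (leaf_chol eta sg).

Lemma chart_differentiable i x : dom i x -> differentiable (phi i) x.
Proof. by have [+ _] := @Ck_chart R eta sg 1 i; apply. Qed.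

Lemma near_dom i x : dom i x -> \forall y \near x, dom i y.
Proof. by move=> Ux; apply: open_nbhs_nbhs; split => //; exact: chart_dom_open. Qed.

(** If the differential kills [u], then the entries of A are stationary along
    [u].  So is t, a function of A, and therefore any function of t; so are the
    entries of the rotation A L(t)^-1, then the projection onto the line of the
    quaternion, and finally the coordinates. *)
Lemma chart_immersion i x : dom i x -> injective ('d (phi i) x).
Proof.
move=> Ux; suff inj u : 'd (phi i) x u = 0 -> u = 0.
  move=> u v e; apply/eqP; rewrite -subr_eq0; apply/eqP; apply: inj.
  by rewrite linearB /= e subrr.
move=> du0; pose St := @stationary R _ x u.
pose c (j p : 'I_3) y : R := lin j (su2_basis R p) (phi i y).
have Sc (j p : 'I_3) : St (c j p).
  have := derive_lin j (su2_basis R p) u (chart_differentiable Ux).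
  by rewrite du0 linear0.
have coord0 k : St (fun y => y 0 k : R) -> u 0 k = 0.
  move=> S; rewrite -(@derive_val _ _ _ _ _ _ _ (is_derive_coord x u k)).
  exact: (@derive_val _ _ _ _ _ _ _ S).
have ui : u 0 i = 0.
  apply: coord0.
  apply: (@stationary_near _ _ _ _
    (fun y => \sum_p c 0 p y * c 0 p y + - ip (entry eta 0) (entry eta 0))).
    near=> y; have Uy : dom i y by near: y; exact: near_dom.
    have /matrixP/(_ 0 0) := chart_gram sg2 Uy.
    rewrite gram_mx ip_basis mxE /= => /(canLR (addKr _)) <-; rewrite addrC.
    by congr (_ + _); apply: eq_bigr => p _; rewrite /c /lin ![ip (su2_basis R p) _]ipC.
  apply: stationaryD; last exact: stationary_cst.
  by apply: stationary_sum => p; apply: stationaryM; exact: Sc.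
(* A function of t is constant on the line through [x] in the direction [u], as
   u_i = 0. *)
have St_t (h : R -> R) : St (fun y => h (y 0 i)).
  by apply: stationary_line => s; rewrite !mxE ui mulr0 add0r.
have St_rot p m : St (fun y => quat_rot (quat i y) p m).
  apply: (@stationary_near _ _ _ _ (fun y => \sum_j c j p y * invmx (L (y 0 i)) j m)).
    near=> y; have Uy : dom i y by near: y; exact: near_dom.
    rewrite -[quat_rot _](mulmxK (chol_unit sg2 Uy)) mxE; apply: eq_bigr => j _.
    by rewrite /c lin_mx_frame.
  apply: stationary_sum => j; apply: stationaryM; first exact: Sc.
  exact: (St_t (fun t => invmx (L t) j m)).
have St_proj k l : St (fun y => line_proj (quat i y) k l).
  apply: (@stationary_near _ _ _ _ (fun y => proj_of_rot (quat_rot (quat i y)) k l)).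
    by near=> y; rewrite proj_of_quat_rot // gt_eqF // quat_sqnorm_chart_gt0.
  exact: stationary_proj_of_rot.
apply/rowP => k; rewrite mxE; have [->//|ki] := eqVneq k i.
apply: coord0.
have li y : line_proj (quat i y) i i = (quat_sqnorm (quat i y))^-1.
  by rewrite /line_proj /quat eqxx !mul1r.
have lk y : line_proj (quat i y) k i = y 0 k / quat_sqnorm (quat i y).
  by rewrite /line_proj /quat eqxx (negPf ki) mulr1.
rewrite (_ : (fun y => _) = fun y => line_proj (quat i y) k i * (line_proj (quat i y) i i)^-1).
  apply: stationaryM; first exact: St_proj.
  apply: stationaryV; last exact: St_proj.
  by rewrite li invr_eq0 gt_eqF // quat_sqnorm_chart_gt0.
by apply/funext => y; rewrite li lk mulfK // invr_eq0 gt_eqF // quat_sqnorm_chart_gt0.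
Unshelve. all: by end_near. Qed.

(** Along a chart the Gram matrix is S + t I, so the range lies in the kernel.
    The four functionals of [gram_tangent_eq0] are injective on the kernel;
    composed with the injective differential they give an injective, hence
    surjective, endomorphism of R^4, so the range is the whole kernel. *)
Lemma chart_tangent i x : dom i x ->
  range ('d (phi i) x) = symplectic_distribution (phi i x).
Proof.
move=> Ux; set a := phi i x.
have a0 : Phi a != 0.
  have [_ /=] := chart_fibre sg2 Ux; apply: contraTneq; rewrite -/a => ->.
  by rewrite mulr0 ltxx.
rewrite symplectic_distributionE //.
have dK u : gram_tangent a ('d (phi i) x u).
  exists (u 0 i) => j k.
  rewrite -(@derive_val _ _ _ _ _ _ _ (gram_derive (chart_differentiable Ux) j k u)).
  have S0 : is_derive x u (fun y => gram eta j k + (y 0 i : R) *+ (j == k)) (u 0 i *+ (j == k)).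
    case: (j == k); last first.
      by rewrite !mulr0n; under eq_fun do rewrite mulr0n; exact: is_derive_cst.
    rewrite mulr1n; under eq_fun do rewrite mulr1n.
    have D := is_deriveD (is_derive_cst (gram eta j k) x u) (is_derive_coord x u i).
    by apply: is_derive_eq D _; rewrite add0r.
  rewrite -(@derive_val _ _ _ _ _ _ _ S0); apply: near_eq_derive.
  near=> y; have Uy : dom i y by near: y; exact: near_dom.
  rewrite -gram_mx chart_gram // mxE.
  by case: (ord3P j) => ->; case: (ord3P k) => ->; rewrite /= ?addr0 // gramC.
apply/seteqP; split=> [_ [u _ <-]//|w wK].
(* The four functionals of [gram_tangent_eq0]. *)
pose C (v : su2_3 R) : 'rV[R]_4 := \row_k nth 0 [:: ip (entry v 0) (entry a 0);
  ip (entry v 0) (entry a 1); ip (entry v 1) (entry a 2); ip (entry v 2) (entry a 0)] k.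
have Clin (c : R) v z : C (c *: v + z) = c *: C v + C z.
  apply/rowP => k; rewrite !mxE !entryD !entryZ !ipDl !ipZl.
  by case: (ord4P k) => ->.
have C00 : C 0 = 0.
  by have := Clin (-1) 0 0; rewrite scaler0 addr0 scaleN1r addNr.
have C0 v : gram_tangent a v -> C v = 0 -> v = 0.
  move=> vK /rowP Cv0; apply: (gram_tangent_eq0 a0 vK).
  - by have := Cv0 0; rewrite !mxE.
  - by have := Cv0 1; rewrite !mxE.
  - by have := Cv0 2; rewrite !mxE.
  - by have := Cv0 3; rewrite !mxE.
have CZ (r : R) v : C (r *: v) = r *: C v.
  by rewrite -[r *: v]addr0 Clin C00 addr0.
pose M : 'M[R]_4 := \matrix_k C ('d (phi i) x (delta_mx 0 k)).
have ME u : C ('d (phi i) x u) = u *m M.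
  rewrite mulmx_sum_row {1}(row_sum_delta u) linear_sum /=.
  under [RHS]eq_bigr do rewrite rowK -CZ -linearZ.
  elim/big_rec2: _ => [|k _ v _ <-]; first exact: C00.
  by rewrite -[X in C (X + _)]scale1r Clin scale1r.
have Mu : M \in unitmx.
  rewrite -row_free_unit -kermx_eq0; apply/eqP/row_matrixP => k; rewrite row0.
  apply: (chart_immersion Ux); rewrite linear0; apply: C0 => //.
  by rewrite ME; apply/sub_kermxP; exact: row_sub.
exists (C w *m invmx M) => //; apply/eqP; rewrite -subr_eq0 -scaleN1r addrC; apply/eqP.
apply: C0; first by apply: gram_tangentD => //; exact: gram_tangentZ.
by rewrite Clin ME mulmxKV // scaleN1r addNr.
Unshelve. all: by end_near. Qed.

Lemma fibre_eta : leafset eta.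
Proof. by []. Qed.

(** The point with q = (1, 1, 1, 1) and t = 0, which lies in all four charts. *)
Definition chart_base i : 'rV[R]_4 := \row_k (k != i)%:R.

Lemma leaf_posdef0 : leaf_posdef eta 0.
Proof.
apply: (@gram_posdef _ _ _ _ _ _ _ (frame_mx eta)).
  apply/matrixP => j k; rewrite gram_mx mxE.
  by case: (ord3P j) => ->; case: (ord3P k) => ->; rewrite /= ?addr0 // ipC.
rewrite -Phi_det3; apply: contraTneq eta0 => ->.
by rewrite mulr0 ltxx.
Qed.

Lemma chart_base_dom i : dom i (chart_base i).
Proof. by rewrite /chart_dom /= mxE eqxx; exact: leaf_posdef0. Qed.

Lemma chart_base_eq i j : phi i (chart_base i) = phi j (chart_base j).
Proof.
have q k : quat k (chart_base k) = fun=> 1.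
  by apply/funext => l; rewrite /quat mxE; case: eqP.
by rewrite /chart !q !mxE !eqxx.
Qed.

(** The values of t in the domain form an interval, unbounded above and
    containing 0, so the domain is star-shaped about the base point. *)
Lemma chart_dom_connected i : connected (dom i).
Proof.
pose b := chart_base i; pose l x (s : R) := s *: (x - b) + b.
have -> : dom i = \bigcup_(x in dom i) (l x @` `[0, 1]%classic).
  apply/seteqP; split=> [x Ux|_ [x Ux [s s01 <-]]].
    exists x => //; exists 1; rewrite /= ?in_itv /= ?ler01 ?lexx //.
    by rewrite /l scale1r subrK.
  move: s01; rewrite /= in_itv /= => /andP[s0 s1].
  have li : l x s 0 i = s * x 0 i by rewrite /l !mxE eqxx subr0 addr0.
  rewrite /chart_dom /= li.
  have [xi|xi] := leP 0 (x 0 i).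
    by apply: posdef_up leaf_posdef0 _; exact: mulr_ge0.
  apply: posdef_up Ux _; rewrite -subr_ge0 -[X in _ - X]mul1r -mulrBl.
  by rewrite mulr_le0 ?subr_le0 // ltW.
apply: bigcup_connected.
  exists b => x _; exists 0; rewrite /= ?in_itv /= ?lexx ?ler01 //.
  by rewrite /l scale0r add0r.
move=> x _; apply: connected_continuous_connected; first exact: segment_connected.
apply: continuous_subspaceT => s; apply: cvgD; last exact: cvg_cst.
by apply: cvgZr_tmp; exact: cvg_id.
Qed.

(** For connectedness: the image of each chart is connected and contains the
    base point, so it lies in the open part that contains the base point. *)
Lemma fibre_integral_submanifold : connected_integral_submanifold
  (@su2_3_star R) (@symplectic_distribution R) leafset.
Proof.
split=> [a [_ /= a0]|].
  by rewrite /su2_3_star /=; apply: contraTneq a0 => ->; rewrite mulr0 ltxx.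
(* The atlas is indexed by all naturals; [inord] repeats chart 0 beyond the
   fourth. *)
exists 4, (fun n => dom (inord n)), (fun n => phi (inord n)).
have overlapE i j := @chart_overlap R eta sg sg2 i j.
have cover : \bigcup_n (phi (inord n) @` dom (inord n)) = leafset.
  apply/seteqP; split=> [_ [n _ [x Ux <-]]|a /(chart_surj sg2)[i [x [Ux <-]]]].
    exact: chart_fibre.
  by exists i => //; rewrite inord_val; exists x.
split.
- split=> //.
  + by move=> n; exact: chart_dom_open.
  + by move=> n; exact: chart_inj.
  + by move=> n m; exact: Ck_chart.
  + by move=> n x; exact: chart_immersion.
  + by move=> n m; rewrite /overlap overlapE; exact: chart_overlap_open.
  + move=> n m; exists (chart_change (inord n) (inord m)).
    rewrite /overlap overlapE; split; first by move=> k; exact: Ck_chart_change.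
    move=> x [Ux qx]; split; last exact: chart_changeE.
    by rewrite /chart_dom /= mxE eqxx.
- by move=> n x; exact: chart_tangent.
split; first by exists eta; exact: fibre_eta.
pose openN := atlas_open_set leafset (fun n => dom (inord n)) (fun n => phi (inord n)).
have base_in A B : openN A -> openN B ->
    A `|` B = leafset -> A `&` B = set0 -> A (phi 0 (chart_base 0)) -> B = set0.
  move=> [AN Ao] [BN Bo] AB AB0 Ab; apply/seteqP; split=> // a Ba.
  have [i [x [Ux xa]]] := chart_surj sg2 (BN _ Ba).
  have := Ao i; have := Bo i; rewrite !inord_val => BoY AoX.
  (* The traces of A and B on the connected domain are complementary open sets,
     and that of A contains the base point. *)
  have XE : dom i `&` phi i @^-1` A = dom i.
    apply: chart_dom_connected.
    - by exists (chart_base i); split; [exact: chart_base_dom|rewrite /= (chart_base_eq i 0)].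
    - by exists (dom i `&` phi i @^-1` A) => //; rewrite setIA setIid.
    - exists (~` (dom i `&` phi i @^-1` B)); first exact: open_closedC.
      apply/seteqP; split=> y [Uy]; [move=> Ay|move=> By]; split=> //.
        by move=> [_ By]; have : set0 (phi i y) by rewrite -AB0; split.
      have : leafset (phi i y) by exact: chart_fibre.
      by rewrite -AB => -[//|By']; case: By; split.
  have [_ Ax] : (dom i `&` phi i @^-1` A) x by rewrite XE.
  by rewrite -AB0; split=> //; rewrite -xa.
move=> A B Aop Bop AB AB0.
have : leafset (phi 0 (chart_base 0)) by apply: chart_fibre => //; exact: chart_base_dom.
rewrite -AB => -[Ab|Bb]; first by right; exact: (base_in A B).
by left; apply: (base_in B A) => //; rewrite 1?setUC 1?setIC.
Qed.

Lemma fibre_leaf N : symplectic_leaf_through eta N <-> N = leafset.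
Proof.
have sg0 : sg != 0.
  by apply: contraTneq eta0 => ->; rewrite mul0r ltxx.
split=> [[[Ni Nmax] Neta]|->].
  apply/esym; apply: (Nmax _ fibre_integral_submanifold).
  exact: (integral_submanifold_sub sg0 Ni Neta eta0).
split; last exact: fibre_eta.
split; first exact: fibre_integral_submanifold.
move=> M Mi NM; apply/seteqP; split=> //.
exact: (integral_submanifold_sub sg0 Mi (NM _ fibre_eta) eta0).
Qed.

End FibreLeaf.

Theorem theorem3p1 (R : realType) :
  (forall eta : su2_3 R, su2_3_plus eta ->
     forall N : set (su2_3 R), symplectic_leaf_through eta N <->
       N = (@f_map R @^-1` [set f_map eta]) `&` @su2_3_plus R) /\
  (forall eta : su2_3 R, su2_3_minus eta ->
     forall N : set (su2_3 R), symplectic_leaf_through eta N <->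
       N = (@f_map R @^-1` [set f_map eta]) `&` @su2_3_minus R).
Proof.
split=> eta eta0 N.
  have -> : @su2_3_plus R = [set a | 0 < 1 * Phi a].
    by apply/funext => a; rewrite /= mul1r.
  by apply: fibre_leaf; rewrite mul1r.
have -> : @su2_3_minus R = [set a | 0 < -1 * Phi a].
  by apply/funext => a; rewrite /= mulN1r oppr_gt0.
by apply: fibre_leaf; rewrite ?mulN1r ?opprK ?oppr_gt0.
Qed.
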